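(* Consider the subset $\mathcal{T}^+$ of $\Sigma^+$ determined by the condition $\lambda\in[b,a]$. This set is a curved tetrahedron, with the following properties: \begin{itemize} \item its vertices are $$V_1\left(\frac{a-b}{\sqrt{a+c}},0,\frac{b+c}{\sqrt{a+c}}\right),\quad V_2\left(-\frac{a-b}{\sqrt{a+c}},0,\frac{b+c}{\sqrt{a+c}}\right),$$ $$V_3\left(0,\frac{a-b}{\sqrt{b+c}},\frac{a+c}{\sqrt{b+c}}\right),\quad V_4\left(0,-\frac{a-b}{\sqrt{b+c}},\frac{a+c}{\sqrt{b+c}}\right);$$ \item the shorter arcs of the conics $\mathcal{C}^{xz}_b$ and $\mathcal{C}^{yz}_a$ determined by $V_1,V_2$ and $V_3,V_4$ respectively are two edges of the tetrahedron; \item those two edges represent self-intersection of $\Sigma^+$; \item the other four edges are determined by the relation $$-a-b+2\lambda+(a-b)\cos2t=0;$$ \item those four edges are cuspidal edges of $\Sigma^+$; \item thus, at each vertex of the tetrahedron, a swallowtail singularity of $\Sigma^+$ occurs. \end{itemize}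
   Context: Fix constants $a>b>0$, $c>0$. In $\mathbf{R}^3$ with coordinates $(x,y,z)$, let $\Sigma^+$ be the parametrized surface $$x=\frac{a-\lambda}{\sqrt{a+c}}\cos t,\quad y=\frac{b-\lambda}{\sqrt{b+c}}\sin t,\quad z=(c+\lambda)\sqrt{\frac{\cos^2t}{a+c}+\frac{\sin^2t}{b+c}},\qquad\lambda\in\mathbf{R},\ t\in[0,2\pi).$$ (It is part of the union of the tropic curves, i.e. the sets of points where the metric induced on the tangent plane by $\langle u,w\rangle=u_1w_1+u_2w_2-u_3w_3$ is degenerate, on the quadrics $\frac{x^2}{a-\lambda}+\frac{y^2}{b-\lambda}+\frac{z^2}{c+\lambda}=1$, with $\lambda$ the parameter of the quadric.) The conics are $$\mathcal{C}^{xz}_b:\ \frac{x^2}{a-b}+\frac{z^2}{c+b}=1,\ y=0,\qquad \mathcal{C}^{yz}_a:\ -\frac{y^2}{a-b}+\frac{z^2}{c+a}=1,\ x=0,$$ an ellipse and a hyperbola respectively. ''Curved tetrahedron'' means a curvilinear tetrahedron with the listed vertices and (curved) edges; ''cuspidal edge'' and ''swallowtail'' are the standard singularity types of surfaces in 3-space. *)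

(* Defs.v *)
From HB Require Import structures.
From mathcomp Require Import all_boot all_order all_algebra.
From mathcomp Require Import all_classical all_reals all_analysis.

Set Implicit Arguments.
Unset Strict Implicit.
Unset Printing Implicit Defensive.

Import Order.TTheory GRing.Theory Num.Theory.
Import numFieldNormedType.Exports.

Local Open Scope classical_set_scope.
Local Open Scope ring_scope.

Notation plane R := (R * R)%type.
Notation space3 R := (R * R * R)%type.

(* [C^k] on a set [U] (used for open [U]): for [k.+1], Frechet differentiable
   with all directional derivatives [C^k], which for open [U] in finite
   dimension amounts to having continuous partial derivatives of order
   at most [k.+1]. *)
Fixpoint Ck_on (R : realType) (V W : normedModType R) (k : nat)
    (U : set V) (f : V -> W) : Prop :=
  if k is k'.+1 then
    (forall x, U x -> differentiable f x) /\
    (forall v, Ck_on k' U (fun x => 'D_v f x))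
  else forall x, U x -> {for x, continuous f}.

Definition smooth_near (R : realType) (V W : normedModType R)
    (f : V -> W) (p : V) : Prop :=
  exists U : set V, [/\ open U, U p & forall k, Ck_on k U f].

Definition diffeo_germ (R : realType) (V W : normedModType R)
    (f : V -> W) (p : V) (q : W) : Prop :=
  exists g : W -> V,
    [/\ f p = q /\ g q = p,
        smooth_near f p, smooth_near g q,
        (\forall x \near p, g (f x) = x) & (\forall y \near q, f (g y) = y)].

(* A-equivalence (right-left equivalence) of the germs of [f] at [p] and
   [g] at [q]. *)
Definition A_equivalent (R : realType) (V W V' W' : normedModType R)
    (f : V -> W) (p : V) (g : V' -> W') (q : V') : Prop :=
  exists (phi : V -> V') (psi : W -> W'),
    [/\ diffeo_germ phi p q, diffeo_germ psi (f p) (g q) &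
        \forall u \near p, psi (f u) = g (phi u)].

Definition std_cuspidal_edge (R : realType) (u : plane R) : space3 R :=
  (u.1, u.2 ^+ 2, u.2 ^+ 3).

Definition std_swallowtail (R : realType) (u : plane R) : space3 R :=
  (3 * u.1 ^+ 4 + u.1 ^+ 2 * u.2, 4 * u.1 ^+ 3 + 2 * u.1 * u.2, u.2).

Definition cuspidal_edge_at (R : realType) (f : plane R -> space3 R)
    (u : plane R) : Prop :=
  A_equivalent f u (@std_cuspidal_edge R) (0, 0).

Definition swallowtail_at (R : realType) (f : plane R -> space3 R)
    (u : plane R) : Prop :=
  A_equivalent f u (@std_swallowtail R) (0, 0).

Definition self_intersection (T : Type) (T' : Type) (f : T -> T')
    (D : set T) : set T' :=
  [set p | exists u v, [/\ D u, D v, u <> v, f u = p & f v = p]].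

Definition euclidean_dist (R : realType) (p q : space3 R) : R :=
  Num.sqrt ((p.1.1 - q.1.1) ^+ 2 + (p.1.2 - q.1.2) ^+ 2 + (p.2 - q.2) ^+ 2).

Definition polygonal_length (R : realType) (a b : R) (g : R -> space3 R)
    (s : seq R) : R :=
  let G := g \o nth b (a :: s) in
  \sum_(0 <= n < size s) euclidean_dist (G n) (G n.+1).

Definition curve_length (R : realType) (a b : R) (g : R -> space3 R) : \bar R :=
  ereal_sup [set (polygonal_length a b g s)%:E | s in itv_partition a b].

Definition is_arc (R : realType) (C : set (space3 R)) (P Q : space3 R)
    (g : R -> space3 R) : Prop :=
  [/\ {within `[0, 1], continuous g}, set_inj `[0, 1] g,
      g @` `[0, 1] `<=` C, g 0 = P & g 1 = Q].

(* [A] is the arc of the curve [C] joining [P] to [Q] which is shorter than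
   any other arc of [C] joining them. On a branch of a hyperbola there is no
   other arc. *)
Definition is_shorter_arc (R : realType) (C : set (space3 R)) (P Q : space3 R)
    (A : set (space3 R)) : Prop :=
  exists g, [/\ is_arc C P Q g, g @` `[0, 1] = A &
    forall g', is_arc C P Q g' -> g' @` `[0, 1] <> A ->
      (curve_length 0 1 g < curve_length 0 1 g')%E].

Definition simplex3 (R : realType) : set 'rV[R]_4 :=
  [set s | (forall i, 0 <= s 0 i) /\ \sum_i s 0 i = 1].

Definition tetrahedron_surface (R : realType) : set 'rV[R]_4 :=
  [set s | simplex3 s /\ exists i, s 0 i = 0].

Definition tetrahedron_edge (R : realType) (i j : 'I_4) : set 'rV[R]_4 :=
  [set s | simplex3 s /\ forall k, k != i -> k != j -> s 0 k = 0].

(* [T] is a curved tetrahedron (a surface, not a solid): the image of the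
   boundary of the standard tetrahedron under a continuous injection (hence,
   by compactness, a homeomorphism onto [T]) carrying the vertices to the
   [V i] and the edge between the vertices [i] and [j] to [E i j]. *)
Definition curved_tetrahedron (R : realType) (T : set (space3 R))
    (V : 'I_4 -> space3 R) (E : 'I_4 -> 'I_4 -> set (space3 R)) : Prop :=
  exists h : 'rV[R]_4 -> space3 R,
    [/\ {within @tetrahedron_surface R, continuous h},
        set_inj (@tetrahedron_surface R) h,
        h @` @tetrahedron_surface R = T,
        (forall i, h (delta_mx 0 i) = V i) &
        (forall i j, i != j -> h @` tetrahedron_edge i j = E i j)].

(* [u] is the pair [(lambda, t)]. The formula makes sense for all real [t]
   and is [2 * pi]-periodic in [t], so that germs at [t = 0] are defined;
   points are counted with [t] in [0, 2 * pi[, i.e. on [param_domain]. *)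
Definition sigma_plus (R : realType) (a b c : R) (u : plane R) : space3 R :=
  let l := u.1 in let t := u.2 in
  ((a - l) / Num.sqrt (a + c) * cos t,
   (b - l) / Num.sqrt (b + c) * sin t,
   (c + l) * Num.sqrt (cos t ^+ 2 / (a + c) + sin t ^+ 2 / (b + c))).

Definition param_domain (R : realType) : set (plane R) :=
  [set u | 0 <= u.2 < 2 * pi].

Definition T_plus (R : realType) (a b c : R) : set (space3 R) :=
  sigma_plus a b c @` [set u | param_domain u /\ b <= u.1 <= a].

Definition conic_xz (R : realType) (a b c : R) : set (space3 R) :=
  [set p | p.1.1 ^+ 2 / (a - b) + p.2 ^+ 2 / (c + b) = 1 /\ p.1.2 = 0].

Definition conic_yz (R : realType) (a b c : R) : set (space3 R) :=
  [set p | - (p.1.2 ^+ 2 / (a - b)) + p.2 ^+ 2 / (c + a) = 1 /\ p.1.1 = 0].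

(* Indexed from 0: [vertex a b c 0] is V_1, ..., [vertex a b c 3] is V_4. *)
Definition vertex (R : realType) (a b c : R) (i : 'I_4) : space3 R :=
  nth (0, 0, 0)
    [:: ((a - b) / Num.sqrt (a + c), 0, (b + c) / Num.sqrt (a + c));
        (- ((a - b) / Num.sqrt (a + c)), 0, (b + c) / Num.sqrt (a + c));
        (0, (a - b) / Num.sqrt (b + c), (a + c) / Num.sqrt (b + c));
        (0, - ((a - b) / Num.sqrt (b + c)), (a + c) / Num.sqrt (b + c))] i.

(* Main.v *)
(* Through a point (x, y, z) of the surface passes the quadric of parameter l;
   clearing denominators, the parameters of the quadrics through a point are the
   roots of a cubic, and on the surface this cubic is (L - l)^2 (L - m) with
   m = a sin^2 t + b cos^2 t. Hence l is determined by the point, so that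
   self-intersections only occur where the map t |-> (x, y, z) fails to be
   injective, i.e. for l = a or l = b. The relation on the other four edges says
   l = m, a triple root. Away from the coordinate planes the coefficients of the
   cubic are local coordinates in space and l, m local coordinates on the
   surface; after a translation of L the surface becomes (s, v^2, v^3). At a
   vertex one of the coordinates x, y vanishes, and it has to replace its square
   among the local coordinates of space; a quadratic change of coordinates then
   gives exactly the standard swallowtail. *)

Require Import Defs.
From HB Require Import structures.
From mathcomp Require Import all_boot all_order all_algebra.
From mathcomp Require Import all_classical all_reals all_analysis.
From mathcomp Require Import ring lra.
Set Implicit Arguments.
Unset Strict Implicit.
Unset Printing Implicit Defensive.
Import Order.TTheory GRing.Theory Num.Theory.
Import numFieldNormedType.Exports.
Local Open Scope classical_set_scope.
Local Open Scope ring_scope.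

(** * Smooth functions *)

(** Every diffeomorphism germ comes with an explicit inverse built from polynomials, square roots
    and a local inverse of the cosine, so smoothness reduces to closure rules. The coefficients of
    the cubic only see squared coordinates; the lost signs are restored from the base point, near
    which a nonzero coordinate keeps its sign.

    The obstacle for the tetrahedron is a map that stays continuous at [l = a] and [l = b], where
    the circle of angles folds onto an arc. With [C = cos t] and [S = sin t], the point
    [(C |C|, - S |S|)] runs round the diamond |X| + |Y| = 1. At the level [l = b + (a - b) q] this
    diamond is pushed onto the inscribed rectangle |X| <= 1 - q, |Y| <= q, whose corners [S^2 = q]
    are exactly the cuspidal points; for q = 0 and q = 1 the rectangle collapses just as the surface
    does.

    For the conics, a competing arc with another image must leave the range of abscissae of the
    short arc, and this overshoot is a fixed surplus of length. *)

Section CkTheory.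
Variable R : realType.
Implicit Types V W : normedModType R.

(** The difference [g - f] vanishes near [x], so it has differential 0 there. *)
Lemma near_eq_differentiable V W (f g : V -> W) x :
  {near x, f =1 g} -> differentiable f x -> differentiable g x.
Proof.
move=> fg df.
have -> : g = f + (g - f) by apply/funext => y /=; rewrite /GRing.add /= addrC subrK.
apply: differentiableD => //.
have lin0 : (g - f) \o shift x = cst ((g - f) x) + (\0 : V -> W) +o_ 0 id.
  apply/eqaddoP => e e0.
  have shc : (fun y => y + x) @ (0 : V) --> x.
    by rewrite -[X in _ --> X]add0r; exact: (cvgD (@cvg_id _ (nbhs (0 : V))) (cvg_cst x)).
  have nfg : \forall y \near (0 : V), f (y + x) = g (y + x) by exact: (shc _ fg).
  near=> y; have fgy : f (y + x) = g (y + x) by near: y.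
  rewrite /=.
  suff -> : ((g - f) \o shift x - (cst ((g - f) x) + \0)) y = 0.
    by rewrite normr0 mulr_ge0 // ltW.
  have E u : (g - f) u = g u - f u by [].
  rewrite -[LHS]/((g - f) (y + x) - ((g - f) x + 0)) !E.
  by rewrite fgy (nbhs_singleton fg) !subrr addr0 subrr.
have cont0 : continuous (\0 : V -> W) by move=> y; exact: cst_continuous.
by apply/diff_locallyP; rewrite (diff_unique cont0 lin0).
Unshelve. all: by end_near. Qed.

(** Lets a directional derivative be replaced by the formula of a differentiation rule, which is
    only available on [U]. *)
Lemma Ck_on_ext V W k (U : set V) (f g : V -> W) :
  open U -> (forall x, U x -> f x = g x) -> Ck_on k U f -> Ck_on k U g.
Proof.
move=> oU; elim: k f g => [|k IH] f g fg /=.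
  move=> cf x Ux; have nU : nbhs x U by exact: open_nbhs_nbhs.
  rewrite /prop_for /continuous_at -(fg _ Ux).
  apply: cvg_trans (cf _ Ux); apply: near_eq_cvg.
  by near=> y; apply: fg; near: y.
move=> [df cf]; split=> [x Ux|v].
  have nfg : {near x, f =1 g}.
    near=> y; apply: fg; near: y.
    exact: open_nbhs_nbhs.
  exact: near_eq_differentiable nfg (df _ Ux).
apply: (IH (fun x => 'D_v f x)) => // x Ux; apply: near_eq_derive.
near=> y; apply: fg; near: y; exact: open_nbhs_nbhs.
Unshelve. all: by end_near. Qed.

Lemma Ck_on_subset V W k (U U' : set V) (f : V -> W) :
  U' `<=` U -> Ck_on k U f -> Ck_on k U' f.
Proof.
move=> sU; elim: k f => [|k IH] f /=; first by move=> cf x /sU; exact: cf.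
by move=> [df cf]; split=> [x /sU|v]; [exact: df|exact: IH].
Qed.

Lemma Ck_onW V W k (U : set V) (f : V -> W) : Ck_on k.+1 U f -> Ck_on k U f.
Proof.
elim: k f => [|k IH] f; first by move=> [df _] x /df; exact: differentiable_continuous.
by move=> [df cf]; split=> // v; apply/IH/cf.
Qed.

Lemma Ck_on_cst V W k (U : set V) (w : W) : Ck_on k U (fun _ => w).
Proof.
elim: k w => [|k IH] w; first by move=> x _; exact: cst_continuous.
split=> [x _|v]; first exact: differentiable_cst.
have -> : (fun x : V => 'D_v (fun=> w) x) = (fun=> 0).
  by apply/funext => x; exact: derive_cst.
exact: IH.
Qed.

Lemma Ck_onD V W k (U : set V) (f g : V -> W) : open U ->
  Ck_on k U f -> Ck_on k U g -> Ck_on k U (fun x => f x + g x).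
Proof.
move=> oU; elim: k f g => [|k IH] f g.
  by move=> cf cg x Ux; apply: cvgD; [exact: cf|exact: cg].
move=> [df cf] [dg cg]; split=> [x Ux|v].
  by apply: differentiableD; [exact: df|exact: dg].
apply: (@Ck_on_ext _ _ _ _ (fun x => 'D_v f x + 'D_v g x)) => //; last first.
  by apply: IH; [exact: cf|exact: cg].
by move=> x Ux; apply/esym/deriveD; apply: diff_derivable; [exact: df|exact: dg].
Qed.

Lemma Ck_onM V k (U : set V) (f g : V -> R) : open U ->
  Ck_on k U f -> Ck_on k U g -> Ck_on k U (fun x => f x * g x).
Proof.
move=> oU; elim: k f g => [|k IH] f g.
  by move=> cf cg x Ux; apply: cvgM; [exact: cf|exact: cg].
move=> /[dup] Cf [df cf] /[dup] Cg [dg cg]; split=> [x Ux|v].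
  by apply: differentiableM; [exact: df|exact: dg].
apply: (@Ck_on_ext _ _ _ _ (fun x => f x * 'D_v g x + g x * 'D_v f x)) => //.
  by move=> x Ux; apply/esym/deriveM; apply: diff_derivable; [exact: df|exact: dg].
by apply: Ck_onD => //; apply: IH; first [exact: cf|exact: cg|exact: Ck_onW].
Qed.

(** With a scalar outer function the chain rule is a product, [h'(f)] times ['D_v f]; the induction
    is generalised over [h] in order to apply to [h']. *)
Lemma Ck_on_comp V k (U : set V) (I : set R) (f : V -> R) (h : R -> R) :
  open U -> (forall x, U x -> I (f x)) ->
  Ck_on k I h -> Ck_on k U f -> Ck_on k U (fun x => h (f x)).
Proof.
move=> oU UI; elim: k f UI h => [|k IH] f UI h.
  move=> ch cf x Ux; apply: (@continuous_comp _ _ _ f h); first exact: cf.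
  exact: ch (UI _ Ux).
move=> [dh ch] /[dup] Cf [df cf]; split=> [x Ux|v].
  by apply: differentiable_comp; [exact: df|exact: dh (UI _ Ux)].
apply: (@Ck_on_ext _ _ _ _ (fun x => 'D_1 h (f x) * 'D_v f x)) => //.
  move=> x Ux; have dfx := df _ Ux; have dhx := dh _ (UI _ Ux).
  rewrite (deriveE v (differentiable_comp dfx dhx)) diff_comp //= !deriveE //.
  by rewrite -[X in _ = 'd h _ X]mulr1 [RHS]linearZ /= mulrC.
apply: Ck_onM => //; last exact: cf.
by apply: (IH f UI ('D_1 h)); [exact: ch|exact: Ck_onW].
Qed.

Lemma Ck_on_pair V W W' k (U : set V) (f : V -> W) (g : V -> W') : open U ->
  Ck_on k U f -> Ck_on k U g -> Ck_on k U (fun x => (f x, g x)).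
Proof.
move=> oU; elim: k f g => [|k IH] f g.
  by move=> cf cg x Ux; apply: cvg_pair; [exact: cf|exact: cg].
move=> [df cf] [dg cg]; split=> [x Ux|v].
  by apply: differentiable_pair; [exact: df|exact: dg].
apply: (@Ck_on_ext _ _ _ _ (fun x => ('D_v f x, 'D_v g x))) => //; last first.
  by apply: IH; [exact: cf|exact: cg].
move=> x Ux; have dfx := df _ Ux; have dgx := dg _ Ux.
by rewrite (deriveE v (differentiable_pair dfx dgx)) diff_pair //= !deriveE.
Qed.

Lemma Ck_on_linear_comp V W W' k (U : set V) (f : V -> W) (l : {linear W -> W'}) :
  open U -> continuous l -> Ck_on k U f -> Ck_on k U (fun x => l (f x)).
Proof.
move=> oU cl; elim: k f => [|k IH] f.
  move=> cf x Ux; apply: (@continuous_comp _ _ _ f l); [exact: cf|exact: cl].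
have dl y : differentiable l y by exact: linear_differentiable.
move=> [df cf]; split=> [x Ux|v].
  by apply: differentiable_comp; [exact: df|exact: dl].
apply: (@Ck_on_ext _ _ _ _ (fun x => l ('D_v f x))) => //; last exact/IH/cf.
move=> x Ux; have dfx := df _ Ux.
rewrite (deriveE v (differentiable_comp dfx (dl (f x)))) diff_comp //= deriveE //.
by rewrite diff_lin.
Qed.

Lemma Ck_on_id V k (U : set V) : Ck_on k U (fun x => x).
Proof.
case: k => [|k]; first by move=> x _; exact: cvg_id.
split=> [x _|v]; first exact: ex_diff.
have -> : (fun x => 'D_v (fun y : V => y) x) = (fun=> v).
  by apply/funext => x; exact: derive_id.
exact: Ck_on_cst.
Qed.

Lemma Ck_on_continuous V W k (U : set V) (f : V -> W) :
  Ck_on k U f -> forall x, U x -> {for x, continuous f}.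
Proof. by elim: k f => [//|k IH] f /Ck_onW /IH. Qed.

(** On the line ['D_v f] is [v] times the ordinary derivative, so one derivative settles all
    directions. *)
Lemma Ck_on_Rderive k (U : set R) (f df : R -> R) : open U ->
  (forall x, U x -> is_derive x 1 f (df x)) ->
  Ck_on k U df -> Ck_on k.+1 U f.
Proof.
move=> oU fdf cdf.
have dif x : U x -> differentiable f x.
  by move=> Ux; apply/derivable1_diffP; case: (fdf _ Ux).
split=> // v.
apply: (@Ck_on_ext _ _ _ _ (fun x => v * df x)) => // [x Ux|].
  rewrite deriveE; last exact: dif.
  rewrite -[X in 'd f _ X]mulr1 [RHS]linearZ /=; congr (_ * _).
  rewrite -deriveE; last exact: dif.
  by case: (fdf _ Ux).
by apply: Ck_onM => //; exact: Ck_on_cst.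
Qed.

Lemma nonzero_open : open [set x : R | x != 0].
Proof. exact: open_neq. Qed.

Lemma Ck_on_inv k : Ck_on k [set x : R | x != 0] (fun x : R => x^-1).
Proof.
have o := nonzero_open.
elim: k => [|k IH]; first by move=> x x0; exact: inv_continuous.
apply: (@Ck_on_Rderive _ _ _ (fun x => - 1 * (x^-1 * x^-1))) ; [by []| |].
  move=> x x0; have dx := differentiable_Rinv x0.
  split; first exact/derivable1_diffP.
  by rewrite deriveE // diff_Rinv // mulN1r -invfM -expr2 /GRing.scale /= mulr1.
apply: Ck_onM => //; first exact: Ck_on_cst.
exact: Ck_onM.
Qed.

Lemma Ck_on_sqrt k : Ck_on k [set x : R | 0 < x] (@Num.sqrt R).
Proof.
have o : open [set x : R | 0 < x] by exact: open_gt.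
elim: k => [|k IH]; first by move=> x _; exact: sqrt_continuous.
apply: (Ck_on_Rderive o (fun x x0 => is_derive1_sqrt x0)).
apply: (@Ck_on_comp _ _ _ [set x | x != 0] _ (fun x => x^-1)) => // [x /= x0||].
- by rewrite mulf_neq0 // gt_eqF // sqrtr_gt0.
- exact: Ck_on_inv.
by apply: Ck_onM => //; exact: Ck_on_cst.
Qed.

Lemma Ck_on_sin_cos k : Ck_on k [set: R] (@sin R) /\ Ck_on k [set: R] (@cos R).
Proof.
have o : open [set: R] by exact: openT.
elim: k => [|k [IHs IHc]].
  by split=> x _; [exact: continuous_sin|exact: continuous_cos].
split.
  by apply: (Ck_on_Rderive o (fun x _ => is_derive_sin x)).
apply: (@Ck_on_Rderive _ _ _ (fun x => -1 * sin x));
  [by []|by move=> x _; rewrite mulN1r; exact: is_derive_cos|].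
by apply: Ck_onM => //; exact: Ck_on_cst.
Qed.

Lemma Ck_on_asin k : Ck_on k [set x : R | -1 < x < 1] (@asin R).
Proof.
have o : open [set x : R | -1 < x < 1].
  rewrite (_ : [set x | _] = `]-1, 1[%classic); first exact: interval_open.
  by apply/seteqP; split=> x /=; rewrite in_itv.
case: k => [|k].
  by move=> x x1; exact: continuous_asin.
apply: (Ck_on_Rderive o (fun x x1 => is_derive1_asin x1)).
have x1 (x : R) : -1 < x < 1 -> 0 < 1 - x ^+ 2 by move=> /andP[? ?]; nra.
apply: (@Ck_on_comp _ _ _ [set x | x != 0] _ (fun x => x^-1)) => // [x /= /x1 x0||].
- by rewrite gt_eqF // sqrtr_gt0.
- exact: Ck_on_inv.
apply: (@Ck_on_comp _ _ _ [set x | 0 < x]) => //; first exact: Ck_on_sqrt.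
have -> : (fun x : R => 1 - x ^+ 2) = (fun x => 1 + -1 * (x * x)).
  by apply/funext => x; ring.
apply: Ck_onD => //; first exact: Ck_on_cst.
apply: Ck_onM => //; first exact: Ck_on_cst.
by apply: Ck_onM => //; exact: Ck_on_id.
Qed.

End CkTheory.

(** * Smooth germs and their closure rules *)

Section SmoothNear.
Variable R : realType.
Implicit Types V W : normedModType R.

Lemma smooth_near_cst V W (w : W) (p : V) : smooth_near (fun=> w) p.
Proof. exists setT; split=> [|//|k]; [exact: openT|exact: Ck_on_cst]. Qed.

Lemma smooth_near_id V (p : V) : smooth_near (fun x => x) p.
Proof. exists setT; split=> [|//|k]; [exact: openT|exact: Ck_on_id]. Qed.

Lemma smooth_nearD V W (f g : V -> W) (p : V) :
  smooth_near f p -> smooth_near g p -> smooth_near (fun x => f x + g x) p.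
Proof.
move=> [U [oU Up cf]] [U' [oU' U'p cg]]; have oUU := openI oU oU'.
exists (U `&` U'); split=> // k.
by apply: Ck_onD => //; [apply: Ck_on_subset (cf k)|apply: Ck_on_subset (cg k)] => x [].
Qed.

Lemma smooth_nearM V (f g : V -> R) (p : V) :
  smooth_near f p -> smooth_near g p -> smooth_near (fun x => f x * g x) p.
Proof.
move=> [U [oU Up cf]] [U' [oU' U'p cg]]; have oUU := openI oU oU'.
exists (U `&` U'); split=> // k.
by apply: Ck_onM => //; [apply: Ck_on_subset (cf k)|apply: Ck_on_subset (cg k)] => x [].
Qed.

Lemma smooth_near_pair V W W' (f : V -> W) (g : V -> W') (p : V) :
  smooth_near f p -> smooth_near g p -> smooth_near (fun x => (f x, g x)) p.
Proof.
move=> [U [oU Up cf]] [U' [oU' U'p cg]]; have oUU := openI oU oU'.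
exists (U `&` U'); split=> // k.
by apply: Ck_on_pair => //; [apply: Ck_on_subset (cf k)|apply: Ck_on_subset (cg k)] => x [].
Qed.

Lemma smooth_near_fst V W W' (f : V -> W * W') (p : V) :
  smooth_near f p -> smooth_near (fun x => (f x).1) p.
Proof.
move=> [U [oU Up cf]]; exists U; split=> // k.
by apply: (Ck_on_linear_comp (l := fst)) => // y; exact: cvg_fst.
Qed.

Lemma smooth_near_snd V W W' (f : V -> W * W') (p : V) :
  smooth_near f p -> smooth_near (fun x => (f x).2) p.
Proof.
move=> [U [oU Up cf]]; exists U; split=> // k.
by apply: (Ck_on_linear_comp (l := snd)) => // y; exact: cvg_snd.
Qed.

Lemma smooth_near_comp V (f : V -> R) (h : R -> R) (p : V) :
  smooth_near h (f p) -> smooth_near f p -> smooth_near (fun x => h (f x)) p.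
Proof.
move=> [I [oI Ip ch]] [U [oU Up cf]].
have oUI : open (U `&` f @^-1` I).
  rewrite openE => x [Ux Ifx]; apply: filterI; first exact: open_nbhs_nbhs.
  by apply: (Ck_on_continuous (cf 0%N) Ux); exact: open_nbhs_nbhs.
exists (U `&` f @^-1` I); split=> // k.
apply: (@Ck_on_comp _ _ _ _ I) => // [x []//|].
by apply: Ck_on_subset (cf k) => x [].
Qed.

Lemma smooth_nearN V (f : V -> R) (p : V) :
  smooth_near f p -> smooth_near (fun x => - f x) p.
Proof.
move=> sf; have -> : (fun x => - f x) = (fun x => -1 * f x).
  by apply/funext => x; rewrite mulN1r.
by apply: smooth_nearM => //; exact: smooth_near_cst.
Qed.

Lemma smooth_nearX V (f : V -> R) n (p : V) :
  smooth_near f p -> smooth_near (fun x => f x ^+ n) p.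
Proof.
move=> sf; elim: n => [|n IH]; first exact: smooth_near_cst.
have -> : (fun x => f x ^+ n.+1) = (fun x => f x * f x ^+ n).
  by apply/funext => x; rewrite exprS.
exact: smooth_nearM.
Qed.

Lemma smooth_near_sqrt V (f : V -> R) (p : V) : 0 < f p ->
  smooth_near f p -> smooth_near (fun x => Num.sqrt (f x)) p.
Proof.
move=> fp; apply: smooth_near_comp; exists [set x : R | 0 < x].
by split=> [|//|k]; [exact: open_gt|exact: Ck_on_sqrt].
Qed.

Lemma smooth_near_cos V (f : V -> R) (p : V) :
  smooth_near f p -> smooth_near (fun x => cos (f x)) p.
Proof.
apply: smooth_near_comp; exists setT; split=> [|//|k]; first exact: openT.
by have [] := Ck_on_sin_cos R k.
Qed.

Lemma smooth_near_asin V (f : V -> R) (p : V) : -1 < f p < 1 ->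
  smooth_near f p -> smooth_near (fun x => asin (f x)) p.
Proof.
move=> fp; apply: smooth_near_comp; exists [set x : R | -1 < x < 1]; split=> //.
  rewrite (_ : [set x | _] = `]-1, 1[%classic); first exact: interval_open.
  by apply/seteqP; split=> x /=; rewrite in_itv.
by move=> k; exact: Ck_on_asin.
Qed.

Lemma smooth_near_continuous V W (f : V -> W) p :
  smooth_near f p -> {for p, continuous f}.
Proof. by move=> [U [_ Up cf]]; exact: (Ck_on_continuous (cf 0%N)). Qed.

End SmoothNear.

(** Square roots and arcsines stay outside: they carry conditions on the value at the base point. *)
Ltac smooth := repeat first
  [ assumption | exact: smooth_near_cst | exact: smooth_near_id
  | apply: smooth_near_pair | apply: smooth_nearX | apply: smooth_nearN
  | apply: smooth_nearD | apply: smooth_nearM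
  | apply: smooth_near_fst | apply: smooth_near_snd | apply: smooth_near_cos ].

Lemma near_gt0 (R : realType) (T : topologicalType) (f : T -> R) p :
  {for p, continuous f} -> 0 < f p -> \forall x \near p, 0 < f x.
Proof. by move=> cf fp; exact: (cvgr_gt (f p) cf). Qed.

(* The inverse is [y |-> theta + asin (sin (acos y - theta))], with the sine
   of the difference expanded. *)
Lemma cos_local_inverse (R : realType) (theta : R) : sin theta != 0 ->
  exists g : R -> R,
    [/\ g (cos theta) = theta, smooth_near g (cos theta),
        \forall t \near theta, g (cos t) = t &
        \forall y \near cos theta, cos (g y) = y].
Proof.
move=> s0; set e := Num.sg (sin theta).
have e2 : e * e = 1 by rewrite -expr2 sqr_sg s0.
have es : e * `|sin theta| = sin theta by rewrite -numEsg.
have cs := cos2Dsin2 theta.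
(* [r] expresses the sine by the cosine on the branch through [theta], the sign [e] choosing the
   branch. At [y = cos t], [phi] and [psi] are the sine and cosine of [t - theta]. *)
pose r y := e * Num.sqrt (1 - y ^+ 2).
pose phi y := r y * cos theta - y * sin theta.
pose psi y := y * cos theta + r y * sin theta.
have s2 t : 1 - cos t ^+ 2 = sin t ^+ 2 by rewrite -(cos2Dsin2 t); ring.
have r0 : r (cos theta) = sin theta by rewrite /r s2 sqrtr_sqr.
have phi0 : phi (cos theta) = 0 by rewrite /phi r0; ring.
have psi0 : psi (cos theta) = 1 by rewrite /psi r0 -cs; ring.
have pos0 : 0 < 1 - cos theta ^+ 2 by rewrite s2 exprn_even_gt0.
have sr : smooth_near r (cos theta).
  apply: smooth_nearM; first exact: smooth_near_cst.
  by apply: smooth_near_sqrt => //; smooth.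
have sphi : smooth_near phi (cos theta).
  by rewrite /phi; smooth.
have spsi : smooth_near psi (cos theta).
  by rewrite /psi; smooth.
exists (fun y => theta + asin (phi y)); split.
- rewrite phi0 -(sin0 R) sinK ?addr0 // in_itv /=.
  by rewrite oppr_le0 divr_ge0 ?pi_ge0.
- apply: smooth_nearD; first exact: smooth_near_cst.
  by apply: smooth_near_asin => //; rewrite phi0 ltrN10 ltr01.
- have cet : {for theta, continuous (fun t => e * sin t)}.
    by apply: cvgM; [exact: cvg_cst|exact: continuous_sin].
  have et0 : 0 < e * sin theta by rewrite -es mulrA e2 mul1r normr_gt0.
  have nes := near_gt0 cet et0.
  have pi2 : 0 < pi / 2 :> R by rewrite divr_gt0 ?pi_gt0.
  near=> t.
  have et : 0 < e * sin t by near: t.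
  have tt : `|t - theta| < pi / 2.
    rewrite distrC; near: t; exact: cvgr_dist_lt.
  have rt : r (cos t) = sin t.
    rewrite /r s2 sqrtr_sqr.
    have -> : `|sin t| = e * sin t.
      rewrite -(ger0_norm (ltW et)) normrM.
      have -> : `|e| = 1 by rewrite normr_sg s0.
      by rewrite mul1r.
    by rewrite mulrA e2 mul1r.
  have -> : phi (cos t) = sin (t - theta) by rewrite /phi rt sinB; ring.
  rewrite sinK; first ring.
  by rewrite in_itv /= -ler_norml ltW.
(* [cos (asin (phi y))] is the nonnegative root of [psi y ^+ 2]; it is [psi y] itself because [psi]
   is positive near [cos theta], where it takes the value 1. *)
- have npsi : \forall y \near cos theta, 0 < psi y.
    by apply: near_gt0; [exact: smooth_near_continuous|rewrite psi0].
  have npos : \forall y \near cos theta, 0 < 1 - y ^+ 2.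
    have c1 : {for cos theta, continuous (fun y : R => 1 - y ^+ 2)}.
      by apply: smooth_near_continuous; smooth.
    exact: near_gt0 c1 pos0.
  near=> y.
  have psi_gt0 : 0 < psi y by near: y.
  have y1 : 0 < 1 - y ^+ 2 by near: y.
  have ry : r y ^+ 2 = 1 - y ^+ 2.
    by rewrite /r exprMn expr2 e2 mul1r sqr_sqrtr // ltW.
  have phipsi : phi y ^+ 2 + psi y ^+ 2 = 1.
    transitivity ((r y ^+ 2 + y ^+ 2) * (cos theta ^+ 2 + sin theta ^+ 2)).
      by rewrite /phi /psi; ring.
    by rewrite ry cs mulr1 subrK.
  have phi1 : -1 <= phi y <= 1 by apply/andP; split; nra.
  rewrite cosD asinK; last by rewrite in_itv.
  rewrite cos_asin //.
  have -> : 1 - phi y ^+ 2 = psi y ^+ 2 by rewrite -phipsi; ring.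
  rewrite sqrtr_sqr gtr0_norm //.
  transitivity (y * (cos theta ^+ 2 + sin theta ^+ 2)); last by rewrite cs mulr1.
  by rewrite /phi /psi; ring.
Unshelve. all: by end_near. Qed.

(** * The cubic of a point *)

Section CubicCoefficients.
Variables (R : realType) (a b c : R).

(* The point with squared coordinates [X], [Y], [Z] lies on the quadric of
   parameter [L] iff [L ^+ 3 - e1 * L ^+ 2 + e2 * L - e3 = 0]. *)
Definition cubic_e1 (X Y Z : R) : R := a + b - c - X - Y + Z.
Definition cubic_e2 (X Y Z : R) : R :=
  a * b - (a + b) * c - X * (b - c) - Y * (a - c) + Z * (a + b).
Definition cubic_e3 (X Y Z : R) : R := X * b * c + Y * a * c + Z * a * b - a * b * c.
Definition cubic (e1 e2 e3 L : R) : R := L ^+ 3 - e1 * L ^+ 2 + e2 * L - e3.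
(** The numbers a, b, - c are the poles of the equation of the quadrics in L. Once denominators are
    cleared, a single squared coordinate survives at each of them, so the value of the cubic there
    gives that square. *)
Definition sqx (e1 e2 e3 : R) : R := cubic e1 e2 e3 a / ((a - b) * (a + c)).
Definition sqy (e1 e2 e3 : R) : R := - cubic e1 e2 e3 b / ((a - b) * (b + c)).
Definition sqz (e1 e2 e3 : R) : R := - cubic e1 e2 e3 (- c) / ((a + c) * (b + c)).

Hypotheses (hab : a != b) (hac : 0 < a + c) (hbc : 0 < b + c).

Let nab : a - b != 0. Proof. by rewrite subr_eq0. Qed.
Let nac : a + c != 0. Proof. exact: lt0r_neq0. Qed.
Let nbc : b + c != 0. Proof. exact: lt0r_neq0. Qed.

Lemma sqx_coef X Y Z :
  sqx (cubic_e1 X Y Z) (cubic_e2 X Y Z) (cubic_e3 X Y Z) = X.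
Proof. by rewrite /sqx /cubic /cubic_e1 /cubic_e2 /cubic_e3; field; rewrite nab nac. Qed.

Lemma sqy_coef X Y Z :
  sqy (cubic_e1 X Y Z) (cubic_e2 X Y Z) (cubic_e3 X Y Z) = Y.
Proof. by rewrite /sqy /cubic /cubic_e1 /cubic_e2 /cubic_e3; field; rewrite nab nbc. Qed.

Lemma sqz_coef X Y Z :
  sqz (cubic_e1 X Y Z) (cubic_e2 X Y Z) (cubic_e3 X Y Z) = Z.
Proof. by rewrite /sqz /cubic /cubic_e1 /cubic_e2 /cubic_e3; field; rewrite nac nbc. Qed.

Lemma cubic_e1_sq e1 e2 e3 :
  cubic_e1 (sqx e1 e2 e3) (sqy e1 e2 e3) (sqz e1 e2 e3) = e1.
Proof. by rewrite /sqx /sqy /sqz /cubic /cubic_e1; field; rewrite nab nac nbc. Qed.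

Lemma cubic_e2_sq e1 e2 e3 :
  cubic_e2 (sqx e1 e2 e3) (sqy e1 e2 e3) (sqz e1 e2 e3) = e2.
Proof. by rewrite /sqx /sqy /sqz /cubic /cubic_e2; field; rewrite nab nac nbc. Qed.

Lemma cubic_e3_sq e1 e2 e3 :
  cubic_e3 (sqx e1 e2 e3) (sqy e1 e2 e3) (sqz e1 e2 e3) = e3.
Proof. by rewrite /sqx /sqy /sqz /cubic /cubic_e3; field; rewrite nab nac nbc. Qed.

Section OnSurface.
Variables (l S : R).
Let m := b + (a - b) * S.
Let X := (a - l) ^+ 2 / (a + c) * (1 - S).
Let Y := (b - l) ^+ 2 / (b + c) * S.
Let Z := (c + l) ^+ 2 * ((1 - S) / (a + c) + S / (b + c)).

(** [S] stands for sin^2 t; these are the Vieta relations for the roots l, l, m. *)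
Lemma cubic_e1_surface : cubic_e1 X Y Z = 2 * l + m.
Proof. by rewrite /cubic_e1 /X /Y /Z /m; field; rewrite nac nbc. Qed.

Lemma cubic_e2_surface : cubic_e2 X Y Z = l ^+ 2 + 2 * l * m.
Proof. by rewrite /cubic_e2 /X /Y /Z /m; field; rewrite nac nbc. Qed.

Lemma cubic_e3_surface : cubic_e3 X Y Z = l ^+ 2 * m.
Proof. by rewrite /cubic_e3 /X /Y /Z /m; field; rewrite nac nbc. Qed.

End OnSurface.
End CubicCoefficients.

(** Inverts squaring on the half-line that contains [x0]. *)
Lemma sg_sqrt_sqr (R : realType) (x x0 : R) :
  0 < Num.sg x0 * x -> Num.sg x0 * Num.sqrt (x ^+ 2) = x.
Proof.
rewrite sqrtr_sqr; have [x0n|x0p|->] := ltgtP x0 0; last by rewrite sgr0 mul0r ltxx.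
- by rewrite ltr0_sg // mulN1r oppr_gt0 => xp; rewrite mulN1r ltr0_norm // opprK.
- by rewrite gtr0_sg // mul1r => xp; rewrite mul1r gtr0_norm.
Qed.

Lemma sg_mul_gt0 (R : realType) (x : R) : x != 0 -> 0 < Num.sg x * x.
Proof. by move=> x0; rewrite -normrEsg normr_gt0. Qed.

Lemma smooth_near_gt0 (R : realType) (V : normedModType R) (f : V -> R) p :
  smooth_near f p -> 0 < f p -> \forall x \near p, 0 < f x.
Proof. by move=> /smooth_near_continuous; exact: near_gt0. Qed.


Section SurfaceSquares.
Variables (R : realType) (a b c : R).
Hypotheses (hac : 0 < a + c) (hbc : 0 < b + c).

Lemma cos2E (t : R) : cos t ^+ 2 = 1 - sin t ^+ 2.
Proof. by rewrite -(cos2Dsin2 t) addrK. Qed.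

Lemma sin2E (t : R) : sin t ^+ 2 = 1 - cos t ^+ 2.
Proof. by rewrite cos2E; ring. Qed.

Lemma cos_double (t : R) : cos (2 * t) = 1 - 2 * sin t ^+ 2.
Proof.
have -> : 2 * t = t + t by ring.
by rewrite cosD -!expr2 cos2E; ring.
Qed.

Lemma sin_double (t : R) : sin (2 * t) = 2 * (sin t * cos t).
Proof. by have -> : 2 * t = t + t by [ring]; rewrite sinD; ring. Qed.

Lemma sigma_plus_sqx (u : plane R) : (sigma_plus a b c u).1.1 ^+ 2 =
  (a - u.1) ^+ 2 / (a + c) * (1 - sin u.2 ^+ 2).
Proof. by rewrite /= !exprMn exprVn sqr_sqrtr ?cos2E // ltW. Qed.

Lemma sigma_plus_sqy (u : plane R) : (sigma_plus a b c u).1.2 ^+ 2 =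
  (b - u.1) ^+ 2 / (b + c) * sin u.2 ^+ 2.
Proof. by rewrite /= !exprMn exprVn sqr_sqrtr // ltW. Qed.

Lemma sigma_plus_sqz (u : plane R) : (sigma_plus a b c u).2 ^+ 2 =
  (c + u.1) ^+ 2 * ((1 - sin u.2 ^+ 2) / (a + c) + sin u.2 ^+ 2 / (b + c)).
Proof.
rewrite /= exprMn -cos2E sqr_sqrtr //.
by apply: addr_ge0; apply: divr_ge0; rewrite ?sqr_ge0 // ltW.
Qed.

Lemma sigma_plus_root_gt0 (C S : R) : C ^+ 2 + S ^+ 2 = 1 ->
  0 < C ^+ 2 / (a + c) + S ^+ 2 / (b + c).
Proof.
move=> CS; have [C0|C0] := eqVneq C 0.
  by rewrite C0 expr0n add0r in CS; rewrite C0 CS expr0n mul0r add0r mul1r invr_gt0.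
apply: ltr_wpDr; first by rewrite divr_ge0 ?sqr_ge0 // ltW.
by rewrite divr_gt0 // exprn_even_gt0.
Qed.

End SurfaceSquares.

(** * Cuspidal edges *)

(** Let s = (2l + m)/3 be the mean of the roots and v = (l - m)/3. In T = L - s the cubic is (T -
    v)^2 (T + 2v) = T^3 - 3 v^2 T + 2 v^3, so the mean and the rescaled coefficients of the
    depressed cubic are s, v^2, v^3. The condition on [sin (2 * t0)] makes m a local coordinate in
    place of t and keeps the point off the planes x = 0 and y = 0. *)
Lemma cuspidal_edge_normal_form (R : realType) (a b c l0 t0 : R) :
  a != b -> 0 < a + c -> 0 < b + c -> sin (2 * t0) != 0 ->
  l0 = b + (a - b) * sin t0 ^+ 2 ->
  cuspidal_edge_at (sigma_plus a b c) (l0, t0).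
Proof.
move=> hab hac hbc st0 l0E.
have nab : a - b != 0 by rewrite subr_eq0.
have nac : a + c != 0 by exact: lt0r_neq0.
have nbc : b + c != 0 by exact: lt0r_neq0.
have [g [g0 sg ng1 ng2]] := cos_local_inverse st0.
have mE t : b + (a - b) * ((1 - cos (2 * t)) / 2) = b + (a - b) * sin t ^+ 2.
  by rewrite cos_double; field.
pose F := sigma_plus a b c.
pose m t := b + (a - b) * ((1 - cos (2 * t)) / 2).
pose phi (u : plane R) : plane R := ((2 * u.1 + m u.2) / 3 - l0, (u.1 - m u.2) / 3).
(* Back from s and v: l = s + v and m = s - 2v, and t is found from cos 2t = 1 - 2 (m - b)/(a -
   b). *)
pose phi' (v : plane R) : plane R :=
  (v.1 + l0 + v.2, g (1 - 2 * ((v.1 + l0 - 2 * v.2 - b) / (a - b))) / 2).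
pose E1 (p : space3 R) := cubic_e1 a b c (p.1.1 ^+ 2) (p.1.2 ^+ 2) (p.2 ^+ 2).
pose E2 (p : space3 R) := cubic_e2 a b c (p.1.1 ^+ 2) (p.1.2 ^+ 2) (p.2 ^+ 2).
pose E3 (p : space3 R) := cubic_e3 a b c (p.1.1 ^+ 2) (p.1.2 ^+ 2) (p.2 ^+ 2).
pose psi (p : space3 R) : space3 R :=
  (E1 p / 3 - l0, E1 p ^+ 2 / 9 - E2 p / 3,
   (E1 p * E2 p / 3 - 2 * E1 p ^+ 3 / 27 - E3 p) / 2).
(* [f1], [f2], [f3] recover the coefficients of the cubic from its depressed form, and [gx], [gy],
   [gz] the squared coordinates. *)
pose f1 (w : space3 R) := 3 * (w.1.1 + l0).
pose f2 (w : space3 R) := 3 * (w.1.1 + l0) ^+ 2 - 3 * w.1.2.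
pose f3 (w : space3 R) := (w.1.1 + l0) * f2 w - 2 * (w.1.1 + l0) ^+ 3 - 2 * w.2.
pose gx w := sqx a b c (f1 w) (f2 w) (f3 w).
pose gy w := sqy a b c (f1 w) (f2 w) (f3 w).
pose gz w := sqz a b c (f1 w) (f2 w) (f3 w).
pose p0 := F (l0, t0).
pose psi' (w : space3 R) : space3 R :=
  (Num.sg p0.1.1 * Num.sqrt (gx w), Num.sg p0.1.2 * Num.sqrt (gy w),
   Num.sg p0.2 * Num.sqrt (gz w)).
have psiF u : psi (F u) = std_cuspidal_edge (phi u).
  rewrite /psi /E1 /E2 /E3 sigma_plus_sqx // sigma_plus_sqy // sigma_plus_sqz //.
  rewrite cubic_e1_surface // cubic_e2_surface // cubic_e3_surface //.
  rewrite /std_cuspidal_edge /phi /m /= mE.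
  by congr ((_, _), _); field.
have f1psi p : f1 (psi p) = E1 p by rewrite /f1 /=; field.
have f2psi p : f2 (psi p) = E2 p by rewrite /f2 /=; field.
have f3psi p : f3 (psi p) = E3 p by rewrite /f3 f2psi /=; field.
have gxpsi p : gx (psi p) = p.1.1 ^+ 2.
  by rewrite /gx f1psi f2psi f3psi sqx_coef.
have gypsi p : gy (psi p) = p.1.2 ^+ 2.
  by rewrite /gy f1psi f2psi f3psi sqy_coef.
have gzpsi p : gz (psi p) = p.2 ^+ 2.
  by rewrite /gz f1psi f2psi f3psi sqz_coef.
have phi0 : phi (l0, t0) = (0, 0).
  by rewrite /phi /m /= mE -l0E; congr (_, _); field.
have w0E : std_cuspidal_edge (0, 0) = psi p0 by rewrite psiF phi0.
move: st0; rewrite sin_double !mulf_eq0 !negb_or => /and3P[_ s0 c0].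
(* On the edge a - l0 and b - l0 are multiples of cos^2 t0 and sin^2 t0, so x and y are multiples of
   cos^3 t0 and sin^3 t0. *)
have p0x : p0.1.1 != 0.
  apply: mulf_neq0 => //; apply: mulf_neq0; last by rewrite invr_eq0 gt_eqF ?sqrtr_gt0.
  rewrite /=.
  have -> : a - l0 = (a - b) * cos t0 ^+ 2 by rewrite cos2E l0E; ring.
  by rewrite mulf_neq0 ?expf_neq0.
have p0y : p0.1.2 != 0.
  apply: mulf_neq0 => //; apply: mulf_neq0; last by rewrite invr_eq0 gt_eqF ?sqrtr_gt0.
  rewrite /=.
  have -> : b - l0 = - ((a - b) * sin t0 ^+ 2) by rewrite l0E; ring.
  by rewrite oppr_eq0 mulf_neq0 ?expf_neq0.
have p0z : p0.2 != 0.
  rewrite /p0 /F /= gt_eqF // mulr_gt0 ?sqrtr_gt0 ?sigma_plus_root_gt0 ?cos2Dsin2 //.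
  have -> : c + l0 = (b + c) * cos t0 ^+ 2 + (a + c) * sin t0 ^+ 2.
    by rewrite cos2E l0E; ring.
  by apply: addr_gt0; apply: mulr_gt0 => //; rewrite exprn_even_gt0.
have gx0 : 0 < gx (psi p0) by rewrite gxpsi exprn_even_gt0.
have gy0 : 0 < gy (psi p0) by rewrite gypsi exprn_even_gt0.
have gz0 : 0 < gz (psi p0) by rewrite gzpsi exprn_even_gt0.
have sgx : smooth_near gx (psi p0) by rewrite /gx /sqx /cubic /f3 /f2 /f1; smooth.
have sgy : smooth_near gy (psi p0) by rewrite /gy /sqy /cubic /f3 /f2 /f1; smooth.
have sgz : smooth_near gz (psi p0) by rewrite /gz /sqz /cubic /f3 /f2 /f1; smooth.
pose arg (v : plane R) : R := 1 - 2 * ((v.1 + l0 - 2 * v.2 - b) / (a - b)).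
have arg0 : arg (0, 0) = cos (2 * t0).
  by rewrite /arg /= cos_double l0E; field.
have argphi u : arg (phi u) = cos (2 * u.2).
  by rewrite /arg /phi /m /=; field.
have sarg : smooth_near arg (0, 0) by rewrite /arg; smooth.
exists phi, psi; split.
- exists phi'; split.
  + split=> //; rewrite /phi' -/(arg _) arg0 g0 /=.
    by congr (_, _); field.
  + by rewrite /phi /m; smooth.
  + rewrite /phi'; smooth.
    by apply: (smooth_near_comp (f := arg)) => //; rewrite arg0.
  + have c2 : {for (l0, t0), continuous (fun u : plane R => 2 * u.2)}.
      by apply: smooth_near_continuous; smooth.
    have nc2 : \forall u \near (l0, t0), g (cos (2 * u.2)) = 2 * u.2 := c2 _ ng1.
    near=> u; have gu : g (cos (2 * u.2)) = 2 * u.2 by near: u.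
    rewrite /phi' -/(arg _) argphi gu /phi /=.
    by rewrite [RHS]surjective_pairing; congr (_, _); field.
  + move: ng2; rewrite -arg0 => ng2.
    have nca : \forall v \near (0, 0), cos (g (arg v)) = arg v :=
      smooth_near_continuous sarg ng2.
    near=> v; have gv : cos (g (arg v)) = arg v by near: v.
    rewrite /phi' -/(arg _) /phi /m /=.
    have -> : 2 * (g (arg v) / 2) = g (arg v) by field.
    by rewrite gv /arg [RHS]surjective_pairing; congr (_, _); field.
- rewrite -/F -/p0 w0E; exists psi'; split.
  + by split=> //; rewrite /psi' gxpsi gypsi gzpsi !sg_sqrt_sqr ?sg_mul_gt0 //;
    case: (p0) => [[]].
  + by rewrite /psi /E1 /E2 /E3 /cubic_e1 /cubic_e2 /cubic_e3; smooth.
  + by rewrite /psi'; smooth; apply: smooth_near_sqrt => //;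
    rewrite ?gxpsi ?gypsi ?gzpsi ?exprn_even_gt0.
  + have nx : \forall p \near p0, 0 < Num.sg p0.1.1 * p.1.1.
      by apply: smooth_near_gt0; [smooth|exact: sg_mul_gt0].
    have ny : \forall p \near p0, 0 < Num.sg p0.1.2 * p.1.2.
      by apply: smooth_near_gt0; [smooth|exact: sg_mul_gt0].
    have nz : \forall p \near p0, 0 < Num.sg p0.2 * p.2.
      by apply: smooth_near_gt0; [smooth|exact: sg_mul_gt0].
    near=> p; rewrite /psi' gxpsi gypsi gzpsi !sg_sqrt_sqr; first by case: (p) => [[]].
    * by near: p.
    * by near: p.
    * by near: p.
  + have ngx := smooth_near_gt0 sgx gx0.
    have ngy := smooth_near_gt0 sgy gy0.
    have ngz := smooth_near_gt0 sgz gz0.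
    near=> w.
    have wx : 0 < gx w by near: w.
    have wy : 0 < gy w by near: w.
    have wz : 0 < gz w by near: w.
    rewrite /psi /E1 /E2 /E3 /psi' /= !exprMn !sqr_sg p0x p0y p0z !mul1r.
    rewrite !sqr_sqrtr ?ltW // cubic_e1_sq // cubic_e2_sq // cubic_e3_sq //.
    rewrite [RHS]surjective_pairing [w.1]surjective_pairing /= /f3 /f2 /f1.
    by congr ((_, _), _); field.
- by near=> u; exact: psiF.
Unshelve. all: by end_near. Qed.

(** * Swallowtails *)

(** Serves to treat the planes x = 0 and y = 0 by one argument. *)
Definition swap_if (T : Type) (sw : bool) (p : T * T * T) : T * T * T :=
  if sw then (p.1.2, p.1.1, p.2) else p.

Lemma swap_ifK (T : Type) sw : involutive (@swap_if T sw).
Proof. by case: sw => [[[]]|]. Qed.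

Lemma swap_if_2 (T : Type) sw (p : T * T * T) : (swap_if sw p).2 = p.2.
Proof. by case: sw. Qed.

Lemma smooth_near_swap_if (R : realType) (V : normedModType R) sw
    (f : V -> space3 R) (p : V) :
  smooth_near f p -> smooth_near (fun x => swap_if sw (f x)) p.
Proof. by case: sw => //= sf; smooth. Qed.

(* With [sw = true] this treats the vertices on the other conic, where the
   roles of [a] and [b] are exchanged; hence [a < b] is allowed. *)
Lemma swallowtail_normal_form (R : realType) (sw : bool) (a b c t0 d : R)
    (F : plane R -> space3 R) :
  a != b -> 0 < a + c -> 0 < b + c -> cos (t0 - d) = 0 ->
  (forall u, (swap_if sw (F u)).1.1 ^+ 2 =
     (a - u.1) ^+ 2 / (a + c) * (1 - cos (u.2 - d) ^+ 2)) ->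
  (forall u, (swap_if sw (F u)).1.2 =
     (b - u.1) / Num.sqrt (b + c) * cos (u.2 - d)) ->
  (forall u, (F u).2 ^+ 2 = (c + u.1) ^+ 2 *
    ((1 - cos (u.2 - d) ^+ 2) / (a + c) + cos (u.2 - d) ^+ 2 / (b + c))) ->
  swallowtail_at F (b, t0).
Proof.
move=> hab hac hbc ct0 Fx Fy Fz.
have nab : a - b != 0 by rewrite subr_eq0.
have nac : a + c != 0 by exact: lt0r_neq0.
have nbc : b + c != 0 by exact: lt0r_neq0.
set B := Num.sqrt (b + c) in Fy.
have B0 : 0 < B by rewrite sqrtr_gt0.
have nB : B != 0 by exact: lt0r_neq0.
have BB : B ^+ 2 = b + c by rewrite sqr_sqrtr // ltW.
have st0 : sin (t0 - d) != 0.
  by rewrite -sqrf_eq0 sin2E ct0 expr0n subr0 oner_eq0.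
have [g [g0 sg ng1 ng2]] := cos_local_inverse st0.
rewrite ct0 in g0 sg ng2.
pose k := a - b.
pose phi (u : plane R) : plane R :=
  (cos (u.2 - d), - 2 * (2 * (u.1 - b) + k * cos (u.2 - d) ^+ 2) / k).
pose phi' (v : plane R) : plane R :=
  (b - k * (v.2 / 2 + v.1 ^+ 2) / 2, d + g v.1).
pose px (p : space3 R) := (swap_if sw p).1.1.
pose py (p : space3 R) := (swap_if sw p).1.2.
pose E1 (p : space3 R) := cubic_e1 a b c (px p ^+ 2) (py p ^+ 2) (p.2 ^+ 2).
pose E2 (p : space3 R) := cubic_e2 a b c (px p ^+ 2) (py p ^+ 2) (p.2 ^+ 2).
(* the first two coefficients of the cubic in the variable [L - b] *)
pose D1 p := E1 p - 3 * b.
pose D2 p := E2 p - 2 * b * E1 p + 3 * b ^+ 2.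
(* Put p = l - b, C = cos (t - d) and v = - 2 D1 / k. The shifted roots are p, p, k C^2, so D1 = 2p
   + k C^2 and D2 = p^2 + 2 p k C^2, whence v = - 4p/k - 2 C^2. Then (D1^2 - 4 D2)/k^2 = C^4 - 4 p
   C^2/k = 3 C^4 + C^2 v, while 8 B y/k = - 8 p C/k = 4 C^3 + 2 C v. *)
pose psi (p : space3 R) : space3 R :=
  ((D1 p ^+ 2 - 4 * D2 p) / k ^+ 2, 8 * B * py p / k, - 2 * D1 p / k).
pose fy (w : space3 R) := k * w.1.2 / (8 * B).
pose d1 (w : space3 R) := - k * w.2 / 2.
pose d2 (w : space3 R) := (d1 w ^+ 2 - k ^+ 2 * w.1.1) / 4.
pose f1 (w : space3 R) := d1 w + 3 * b.
pose f2 (w : space3 R) := d2 w + 2 * b * f1 w - 3 * b ^+ 2.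
(* Solves for the last coefficient from the value of the cubic at b, which y^2 prescribes. *)
pose f3 (w : space3 R) :=
  b ^+ 3 - f1 w * b ^+ 2 + f2 w * b + (a - b) * (b + c) * fy w ^+ 2.
pose gx w := sqx a b c (f1 w) (f2 w) (f3 w).
pose gz w := sqz a b c (f1 w) (f2 w) (f3 w).
have sqy_f w : sqy a b c (f1 w) (f2 w) (f3 w) = fy w ^+ 2.
  by rewrite /sqy /cubic /f3; field; rewrite nab nbc.
pose p0 := F (b, t0).
pose psi' (w : space3 R) : space3 R :=
  swap_if sw (Num.sg (px p0) * Num.sqrt (gx w), fy w, Num.sg p0.2 * Num.sqrt (gz w)).
have Fy2 u : py (F u) ^+ 2 = (b - u.1) ^+ 2 / (b + c) * cos (u.2 - d) ^+ 2.
  by rewrite /py Fy !exprMn exprVn BB.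
have psiF u : psi (F u) = std_swallowtail (phi u).
  rewrite /psi /D1 /D2 /E1 /E2 Fy2 /px Fx Fz cubic_e1_surface // cubic_e2_surface //.
  rewrite /std_swallowtail /phi /py Fy /= -/k.
  by congr ((_, _), _); field; rewrite ?nB nab.
have f1psi p : f1 (psi p) = E1 p by rewrite /f1 /d1 /= /D1; field.
have f2psi p : f2 (psi p) = E2 p.
  by rewrite /f2 f1psi /d2 /d1 /= /D2 /D1; field.
have fypsi p : fy (psi p) = py p by rewrite /fy /=; field; rewrite nab nB.
have f3psi p : f3 (psi p) = cubic_e3 a b c (px p ^+ 2) (py p ^+ 2) (p.2 ^+ 2).
  by rewrite /f3 f1psi f2psi fypsi /E1 /E2 /cubic_e1 /cubic_e2 /cubic_e3; ring.
have gxpsi p : gx (psi p) = px p ^+ 2.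
  by rewrite /gx f1psi f2psi f3psi sqx_coef.
have gzpsi p : gz (psi p) = p.2 ^+ 2.
  by rewrite /gz f1psi f2psi f3psi sqz_coef.
have phi0 : phi (b, t0) = (0, 0).
  by rewrite /phi /= ct0; congr (_, _); field.
have w0E : std_swallowtail (0, 0) = psi p0 by rewrite psiF phi0.
have p0x : px p0 != 0.
  rewrite -sqrf_eq0 /px Fx ct0 /= expr0n subr0 mulr1.
  by rewrite mulf_neq0 ?invr_eq0 // expf_neq0.
have p0z : p0.2 != 0.
  rewrite -sqrf_eq0 /p0 Fz ct0 /= expr0n subr0 mul0r addr0 mul1r.
  by rewrite mulf_neq0 ?invr_eq0 // expf_neq0 // addrC.
have gx0 : 0 < gx (psi p0) by rewrite gxpsi exprn_even_gt0.
have gz0 : 0 < gz (psi p0) by rewrite gzpsi exprn_even_gt0.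
have sfy : smooth_near fy (psi p0) by rewrite /fy; smooth.
have sf1 : smooth_near f1 (psi p0) by rewrite /f1 /d1; smooth.
have sf2 : smooth_near f2 (psi p0) by rewrite /f2 /d2 /d1; smooth.
have sf3 : smooth_near f3 (psi p0) by rewrite /f3; smooth.
have sgx : smooth_near gx (psi p0) by rewrite /gx /sqx /cubic; smooth.
have sgz : smooth_near gz (psi p0) by rewrite /gz /sqz /cubic; smooth.
have spx p : smooth_near px p.
  by apply: smooth_near_fst; apply: smooth_near_fst; apply: smooth_near_swap_if; smooth.
have spy p : smooth_near py p.
  by apply: smooth_near_snd; apply: smooth_near_fst; apply: smooth_near_swap_if; smooth.
have spxp0 := spx p0; have spyp0 := spy p0.
exists phi, psi; split.
- exists phi'; split.
  + split=> //; rewrite /phi' /= g0.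
    by congr (_, _); field.
  + by rewrite /phi; smooth.
  + rewrite /phi'; smooth.
    by apply: (smooth_near_comp (f := fst)) => //; smooth.
  + have c2 : {for (b, t0), continuous (fun u : plane R => u.2 - d)}.
      by apply: smooth_near_continuous; smooth.
    have nc2 : \forall u \near (b, t0), g (cos (u.2 - d)) = u.2 - d := c2 _ ng1.
    near=> u; have gu : g (cos (u.2 - d)) = u.2 - d by near: u.
    rewrite /phi' /phi /= gu.
    by rewrite [RHS]surjective_pairing; congr (_, _); field.
  + have c1 : {for (0, 0), continuous (fun v : plane R => v.1)}.
      by apply: smooth_near_continuous; smooth.
    have nca : \forall v \near ((0, 0) : plane R), cos (g v.1) = v.1 := c1 _ ng2.
    near=> v; have gv : cos (g v.1) = v.1 by near: v.
    rewrite /phi /phi' /= [d + _]addrC addrK gv.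
    by rewrite [RHS]surjective_pairing; congr (_, _); field.
- rewrite -/p0 w0E; exists psi'; split.
  + split=> //; rewrite /psi' gxpsi gzpsi fypsi !sg_sqrt_sqr ?sg_mul_gt0 //.
    by rewrite -(swap_if_2 sw p0) -!surjective_pairing swap_ifK.
  + by rewrite /psi /D1 /D2 /E1 /E2 /cubic_e1 /cubic_e2; smooth.
  + apply: smooth_near_swap_if; smooth; apply: smooth_near_sqrt => //.
  + have nx : \forall p \near p0, 0 < Num.sg (px p0) * px p.
      by apply: smooth_near_gt0; [smooth|exact: sg_mul_gt0].
    have nz : \forall p \near p0, 0 < Num.sg p0.2 * p.2.
      by apply: smooth_near_gt0; [smooth|exact: sg_mul_gt0].
    near=> p; rewrite /psi' gxpsi gzpsi fypsi !sg_sqrt_sqr.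
    * by rewrite -(swap_if_2 sw p) -!surjective_pairing swap_ifK.
    * by near: p.
    * by near: p.
  + have ngx := smooth_near_gt0 sgx gx0.
    have ngz := smooth_near_gt0 sgz gz0.
    near=> w.
    have wx : 0 < gx w by near: w.
    have wz : 0 < gz w by near: w.
    have sx : px (psi' w) ^+ 2 = gx w.
      by rewrite /px swap_ifK exprMn sqr_sg p0x mul1r sqr_sqrtr ?ltW.
    have sy : py (psi' w) = fy w by rewrite /py swap_ifK.
    have sz : (psi' w).2 ^+ 2 = gz w.
      by rewrite swap_if_2 exprMn sqr_sg p0z mul1r sqr_sqrtr ?ltW.
    have E1w : E1 (psi' w) = f1 w.
      by rewrite /E1 sx sy sz -sqy_f cubic_e1_sq.
    have E2w : E2 (psi' w) = f2 w.
      by rewrite /E2 sx sy sz -sqy_f cubic_e2_sq.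
    rewrite /psi /D2 /D1 E1w E2w sy.
    rewrite [RHS]surjective_pairing [w.1]surjective_pairing /= /f2 /f1 /d2 /d1 /fy.
    by congr ((_, _), _); field; rewrite ?nB nab.
- by near=> u; exact: psiF.
Unshelve. all: by end_near. Qed.

(** The shift [d = pi / 2] turns the sine, which vanishes at these vertices, into the cosine of the
    normal form. *)
Lemma swallowtail_sin0 (R : realType) (a b c t0 : R) :
  a != b -> 0 < a + c -> 0 < b + c -> sin t0 = 0 ->
  swallowtail_at (sigma_plus a b c) (b, t0).
Proof.
move=> hab hac hbc st0.
have cosE t : cos (t - pi / 2) = sin t by rewrite cosB cos_pihalf sin_pihalf; ring.
apply: (@swallowtail_normal_form _ false a b c t0 (pi / 2)) => //.
- by rewrite cosE.
- by move=> u; rewrite sigma_plus_sqx // cosE.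
- by move=> u; rewrite cosE.
- by move=> u; rewrite sigma_plus_sqz // cosE.
Qed.

Lemma swallowtail_cos0 (R : realType) (a b c t0 : R) :
  a != b -> 0 < a + c -> 0 < b + c -> cos t0 = 0 ->
  swallowtail_at (sigma_plus a b c) (a, t0).
Proof.
move=> hab hac hbc ct0.
apply: (@swallowtail_normal_form _ true b a c t0 0); rewrite ?subr0 1?eq_sym //.
- by move=> u; rewrite subr0 -sin2E; exact: sigma_plus_sqy.
- by move=> u; rewrite subr0.
- by move=> u; rewrite subr0 sigma_plus_sqz // -sin2E -cos2E; congr (_ * _); rewrite addrC.
Qed.

(** * Arcs of conics and their lengths *)

Section PolygonalChains.
Variable R : realType.
Implicit Types (g : R -> space3 R) (s t : seq R).

Fixpoint chain_length g (x : R) s : R :=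
  if s is y :: s' then euclidean_dist (g x) (g y) + chain_length g y s' else 0.

Lemma polygonal_lengthE (x b : R) g s :
  polygonal_length x b g s = chain_length g x s.
Proof.
rewrite /polygonal_length; elim: s x => [|y s IH] x; first by rewrite big_nil.
by rewrite [size _]/= big_nat_recl //= -IH.
Qed.

Lemma chain_length_ge0 g x s : 0 <= chain_length g x s.
Proof. by elim: s x => //= y s IH x; rewrite addr_ge0 // sqrtr_ge0. Qed.

Lemma chain_length_cat g x s t :
  chain_length g x (s ++ t) = chain_length g x s + chain_length g (last x s) t.
Proof. by elim: s x => [|y s IH] x /=; rewrite ?add0r // IH addrA. Qed.

Lemma euclidean_distxx (p : space3 R) : euclidean_dist p p = 0.
Proof. by rewrite /euclidean_dist !subrr !expr0n /= !addr0 sqrtr0. Qed.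

(** Points found by the intermediate value theorem may coincide; repetitions contribute length 0,
    and dropping them gives a genuine partition. *)
Lemma chain_length_strict g x s : path <=%R x s -> exists s',
  [/\ path <%R x s', last x s' = last x s & chain_length g x s' = chain_length g x s].
Proof.
elim: s x => [|y s IH] x /=; first by exists [::].
case/andP; rewrite le_eqVlt => /predU1P[<- /IH [s' [ps' <- <-]]|xy /IH].
  by exists s'; rewrite euclidean_distxx add0r.
by move=> [s' [ps' ls' es']]; exists (y :: s'); rewrite /= xy ps' ls' es'.
Qed.

Lemma chain_length_le_curve_length (x b : R) g s :
  path <=%R x s -> last x s = b -> ((chain_length g x s)%:E <= curve_length x b g)%E.
Proof.
move=> /(chain_length_strict g) [s' [ps' <- <-]] ls.
apply: ereal_sup_ubound; exists s'; first by split=> //; rewrite ls.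
by rewrite polygonal_lengthE.
Qed.

Lemma chain_length_lipschitz g (K x b : R) s :
  (forall y z, x <= y -> y <= z -> z <= b ->
     euclidean_dist (g y) (g z) <= K * (z - y)) ->
  path <%R x s -> last x s <= b -> chain_length g x s <= K * (last x s - x).
Proof.
elim: s x => [|y s IH] x lip /=; first by rewrite subrr mulr0.
move=> /andP[xy ps] lsb.
have yl : y <= last y s.
  elim: (s) (y) ps {IH lsb} => //= z s' IH' w /andP[wz /IH'].
  exact: le_trans (ltW wz).
have -> : K * (last y s - x) = K * (y - x) + K * (last y s - y) by ring.
apply: lerD; first by apply: lip => //; [exact: ltW|exact: le_trans lsb].
by apply: IH => // u v yu; apply: lip; apply: le_trans yu; exact: ltW.
Qed.

End PolygonalChains.

Section ConicArcs.
Variables (R : realType) (sw : bool) (P Q u0 : R).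
Implicit Types (p q : space3 R) (g : R -> space3 R).

(** A common form of both conics: the ellipse has Q < 0 in the plane y = 0, the hyperbola Q > 0 in
    the plane x = 0. *)
Definition axis_conic : set (space3 R) :=
  [set p | p.2 ^+ 2 = P + Q * (swap_if sw p).1.1 ^+ 2 /\ (swap_if sw p).1.2 = 0].

Definition conic_graph (x : R) : space3 R :=
  swap_if sw (x, 0, Num.sqrt (P + Q * x ^+ 2)).

Let u p := (swap_if sw p).1.1.

Lemma axis_conic_dist p q : axis_conic p -> axis_conic q ->
  euclidean_dist p q = Num.sqrt ((u p - u q) ^+ 2 + (p.2 - q.2) ^+ 2).
Proof.
rewrite /axis_conic /euclidean_dist /u.
case: sw => /= -[_ ->] [_ ->]; rewrite subrr expr0n /=; first by rewrite add0r.
by rewrite addr0.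
Qed.

Lemma axis_conic_ext p q : axis_conic p -> axis_conic q ->
  u p = u q -> p.2 = q.2 -> p = q.
Proof.
move: p q => [[p1 p2] p3] [[q1 q2] q3]; rewrite /axis_conic /u.
by case: sw => /= -[_ ->] [_ ->] -> ->.
Qed.

Hypotheses (u0_gt0 : 0 < u0) (P_gt0 : 0 < P) (PQ_gt0 : 0 < P + Q * u0 ^+ 2).

Let f x := P + Q * x ^+ 2.
(** P + Q x^2 is affine in x^2, so its minimum over |x| <= u0 is attained at x = 0 or |x| = u0. *)
Let mu := Num.min P (P + Q * u0 ^+ 2).

Let mu_gt0 : 0 < mu. Proof. by rewrite lt_min P_gt0. Qed.

Let f_ge x : `|x| <= u0 -> mu <= f x.
Proof.
move=> xu; have x2 : x ^+ 2 <= u0 ^+ 2.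
  by rewrite -real_normK ?num_real // lerXn2r ?nnegrE // ltW.
rewrite /mu /f ge_min; have [Q0|Q0] := leP 0 Q.
  by rewrite lerDl mulr_ge0 ?sqr_ge0.
by rewrite lerD2l ler_wnM2l ?orbT // ltW.
Qed.

Let f_gt0 x : `|x| <= u0 -> 0 < f x.
Proof. by move=> /f_ge; exact: lt_le_trans. Qed.

Lemma u_conic_graph x : u (conic_graph x) = x.
Proof. by rewrite /u /conic_graph swap_ifK. Qed.

Lemma conic_graph_in x : `|x| <= u0 -> axis_conic (conic_graph x).
Proof.
move=> xu; rewrite /axis_conic /= swap_if_2 swap_ifK /= sqr_sqrtr //.
by have /ltW := f_gt0 xu.
Qed.

Let g tau := conic_graph (u0 * (1 - 2 * tau)).

Let g_bound tau : 0 <= tau <= 1 -> `|u0 * (1 - 2 * tau)| <= u0.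
Proof.
move=> /andP[t0 t1]; have u1 := mulr_ge0 (ltW u0_gt0) t0.
have u2 : 0 <= u0 * (1 - tau) by rewrite mulr_ge0 ?subr_ge0 // ltW.
by rewrite ler_norml; apply/andP; split; lra.
Qed.

Let g_conic tau : 0 <= tau <= 1 -> axis_conic (g tau).
Proof. by move=> t01; apply: conic_graph_in; exact: g_bound. Qed.

Let lip_const : R := 2 * u0 * (1 + `|Q| * u0 / Num.sqrt mu).

(** Gives the short arc finite length, without which no strict inequality of lengths could follow
    from a surplus. The square root has Lipschitz constant [1 / (2 * Num.sqrt mu)] above [mu]. *)
Lemma conic_graph_lipschitz x y : 0 <= x -> x <= y -> y <= 1 ->
  euclidean_dist (g x) (g y) <= lip_const * (y - x).
Proof.
move=> x0 xy y1.
have hx : 0 <= x <= 1 by rewrite x0 (le_trans xy).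
have hy : 0 <= y <= 1 by rewrite y1 (le_trans x0).
rewrite axis_conic_dist; [|exact: g_conic..].
rewrite !u_conic_graph !swap_if_2 /= -!/(f _).
set X := u0 * _; set Y := u0 * (1 - 2 * y).
have Xb : `|X| <= u0 by exact: g_bound.
have Yb : `|Y| <= u0 by exact: g_bound.
have XY : `|X - Y| = 2 * u0 * (y - x).
  have -> : X - Y = 2 * u0 * (y - x) by rewrite /X /Y; ring.
  by rewrite ger0_norm // !mulr_ge0 ?subr_ge0 // ltW.
have smu : 0 < Num.sqrt mu by rewrite sqrtr_gt0.
have sX : Num.sqrt mu <= Num.sqrt (f X) by rewrite ler_wsqrtr // f_ge.
have sY : Num.sqrt mu <= Num.sqrt (f Y) by rewrite ler_wsqrtr // f_ge.
have tri (v w : R) : Num.sqrt (v ^+ 2 + w ^+ 2) <= `|v| + `|w|.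
  rewrite -[leRHS]ger0_norm ?addr_ge0 // -sqrtr_sqr ler_wsqrtr //.
  rewrite sqrrD !real_normK ?num_real // addrAC lerDl.
  by rewrite mulrn_wge0 // mulr_ge0.
apply: (le_trans (tri _ _)).
suff : `|Num.sqrt (f X) - Num.sqrt (f Y)| <= `|Q| * u0 / Num.sqrt mu * `|X - Y|.
  by rewrite XY /lip_const; lra.
rewrite -(ler_pM2r (x := 2 * Num.sqrt mu)); last by rewrite mulr_gt0.
apply: (@le_trans _ _ (`|f X - f Y|)).
  have -> : f X - f Y = (Num.sqrt (f X) - Num.sqrt (f Y)) * (Num.sqrt (f X) + Num.sqrt (f Y)).
    by rewrite -subr_sqr !sqr_sqrtr // ltW // f_gt0.
  rewrite normrM ler_wpM2l // ger0_norm ?addr_ge0 ?sqrtr_ge0 //; lra.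
have -> : f X - f Y = Q * (X + Y) * (X - Y) by rewrite /f; ring.
rewrite !normrM.
have -> : `|Q| * u0 / Num.sqrt mu * `|X - Y| * (2 * Num.sqrt mu) = `|Q| * (2 * u0) * `|X - Y|.
  by field; exact: lt0r_neq0.
rewrite ler_wpM2r // ler_wpM2l //.
by apply: le_trans (ler_normD _ _) _; lra.
Qed.

Section OtherArc.
Variable g' : R -> space3 R.
Hypothesis arc' : is_arc axis_conic (conic_graph u0) (conic_graph (- u0)) g'.

Let v tau := u (g' tau).
Let C' tau : 0 <= tau <= 1 -> axis_conic (g' tau).
Proof.
by case: arc' => _ _ sub _ _ t01; apply: sub; exists tau; rewrite //= in_itv.
Qed.

Let v0 : v 0 = u0.
Proof. by case: arc' => _ _ _ e _; rewrite /v e u_conic_graph. Qed.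

Let v1 : v 1 = - u0.
Proof. by case: arc' => _ _ _ _ e; rewrite /v e u_conic_graph. Qed.

Let ivt (h : space3 R -> R) (x y w : R) : continuous h ->
  0 <= x -> x <= y -> y <= 1 -> h (g' y) <= w <= h (g' x) ->
  exists2 z, x <= z <= y & h (g' z) = w.
Proof.
case: arc' => cg _ _ _ _ ch x0 xy y1 /andP[w1 w2].
have chg : {within `[x, y], continuous (fun t => h (g' t))}.
  have chg1 : {within `[0, 1], continuous (fun t => h (g' t))}.
    move=> t; apply: (@continuous_comp _ _ _ (g' : subspace `[0, 1] -> _) h).
      exact: cg.
    exact: ch.
  apply: continuous_subspaceW chg1.
  by apply: subset_itv; rewrite bnd_simp.
have [|z] := IVT xy chg (v := w); last by rewrite in_itv; exists z.
by rewrite ge_min w1 orbT le_max w2.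
Qed.

Let cu : continuous u.
Proof.
move=> p; apply: smooth_near_continuous.
by apply: smooth_near_fst; apply: smooth_near_fst; apply: smooth_near_swap_if; smooth.
Qed.

(* The ordinates of [g] have the smallest absolute value over given abscissae
   with fixed sign, so reflecting a point in the plane [z = 0] can only
   lengthen a chord. *)
Let dist_le x y x' y' : 0 <= x <= 1 -> 0 <= y <= 1 -> 0 <= x' <= 1 -> 0 <= y' <= 1 ->
  v x' = u (g x) -> v y' = u (g y) ->
  euclidean_dist (g x) (g y) <= euclidean_dist (g' x') (g' y').
Proof.
move=> hx hy hx' hy' ex ey.
rewrite !axis_conic_dist; try by [exact: g_conic|exact: C'].
rewrite -/(v x') -/(v y') ex ey ler_wsqrtr // lerD2l.
have [z2x _] := C' hx'; have [z2y _] := C' hy'.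
rewrite -/(u _) -/(v x') ex u_conic_graph -/(f _) in z2x.
rewrite -/(u _) -/(v y') ey u_conic_graph -/(f _) in z2y.
rewrite !swap_if_2 /= -!/(f _) -z2x -z2y !sqrtr_sqr.
rewrite !sqrrB !real_normK ?num_real // lerD2r lerD2l lerN2 ler_wMn2r //.
by rewrite -normrM ler_norm.
Qed.

(** The abscissae of a chain on [g] decrease; by the intermediate value theorem [g'] takes them in
    the same order, each search starting where the last one ended. No chord gets shorter. *)
Let chain_le s x x' y' : 0 <= x -> path <%R x s -> last x s <= 1 ->
  0 <= x' -> x' <= y' -> y' <= 1 -> v x' = u (g x) -> v y' = u (g (last x s)) ->
  exists s', [/\ path <=%R x' s', last x' s' = y' &
    chain_length g x s <= chain_length g' x' s'].
Proof.
elim: s x x' => [|y s IH] x x' x0 /= ps ls x'0 xy' y'1 ex ey.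
  by exists [:: y']; rewrite /= xy' addr0 sqrtr_ge0.
move: ps => /andP[xy ps].
have yl : y <= last y s.
  elim: (s) (y) ps {IH ls ey xy} => //= z s' IH' w /andP[wz /IH'].
  exact: le_trans (ltW wz).
have [z /andP[xz zy] ez] : exists2 z, x' <= z <= y' & v z = u (g y).
  apply: ivt => //; rewrite -/(v _) -/(v _) ex ey !u_conic_graph.
  by rewrite !ler_pM2l // !lerD2l !lerN2 !ler_pM2l // yl ltW.
have y0 : 0 <= y by rewrite (le_trans x0) // ltW.
have z0 : 0 <= z by exact: le_trans xz.
have [s' [ps' ls' les']] := IH y z y0 ps ls z0 zy y'1 ez ey.
exists (z :: s'); rewrite /= xz ps' ls'; split=> //; apply: lerD => //.
apply: dist_le => //; rewrite ?x0 ?y0 ?x'0 /=.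
- by rewrite (le_trans (ltW xy)) // (le_trans yl).
- exact: le_trans ls.
- exact: le_trans xy' _.
- by rewrite (le_trans x'0) //= (le_trans zy).
Qed.

(** Some partition comes within [e] of the finite length of [g], so a surplus [e] common to all
    partitions exceeds the supremum strictly. *)
Let excess e : 0 < e ->
  (forall s, itv_partition 0 1 s ->
     ((chain_length g 0 s + e)%:E <= curve_length 0 1 g')%E) ->
  (curve_length 0 1 g < curve_length 0 1 g')%E.
Proof.
move=> e0 H.
have ubL : (curve_length 0 1 g <= lip_const%:E)%E.
  apply: ge_ereal_sup => _ [s [ps /eqP ls] <-]; rewrite lee_fin polygonal_lengthE.
  have := @chain_length_lipschitz _ g lip_const 0 1 s conic_graph_lipschitz ps.
  by rewrite ls lexx subr0 mulr1 => ->.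
have lbL : (0 <= curve_length 0 1 g)%E.
  apply: (@le_trans _ _ (chain_length g 0 [:: 1])%:E).
    by rewrite lee_fin chain_length_ge0.
  by apply: chain_length_le_curve_length; rewrite //= ler01.
have fL : curve_length 0 1 g \is a fin_num.
  by rewrite ge0_fin_numE // (le_lt_trans ubL) // ltry.
have [_ [s ps <-] les] := ub_ereal_sup_adherent e0 fL.
apply: lt_le_trans (H s ps).
by move: les; rewrite polygonal_lengthE lteBlDr.
Qed.

Let dist_ge_u p q : axis_conic p -> axis_conic q -> `|u p - u q| <= euclidean_dist p q.
Proof.
by move=> Cp Cq; rewrite axis_conic_dist // -sqrtr_sqr ler_wsqrtr // lerDl sqr_ge0.
Qed.

(** If [v tau] exceeds [u0], the arc must return to abscissa [u0] after [tau] and only then run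
    across to [- u0]: the detour from time 0 to [tau] is extra length. If [v tau] is below [- u0],
    the detour is at the end. *)
Let overshoot_longer tau : 0 <= tau <= 1 -> u0 < `|v tau| ->
  (curve_length 0 1 g < curve_length 0 1 g')%E.
Proof.
move=> /andP[t0 t1] uv; have u0_gt0' := u0_gt0.
have C0 : axis_conic (g' 0) by apply: C'; rewrite lexx ler01.
have C1 : axis_conic (g' 1) by apply: C'; rewrite lexx ler01.
have Ct : axis_conic (g' tau) by apply: C'; rewrite t0 t1.
have g0 : u (g 0) = u0 by rewrite u_conic_graph mulr0 subr0 mulr1.
have g1 : u (g 1) = - u0 by rewrite u_conic_graph; ring.
apply: (@excess (`|v tau| - u0)); first by rewrite subr_gt0.
move=> s [ps /eqP ls]; have ls1 : last 0 s <= 1 by rewrite ls.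
have [v_ge0|v_lt0] := leP 0 (v tau).
  rewrite ger0_norm // in uv *.
  have [x /andP[tx x1] ex] : exists2 x, tau <= x <= 1 & v x = u0.
    by apply: ivt => //; rewrite -/(v _) -/(v _) v1 (ltW uv) andbT; lra.
  have x0 : 0 <= x by exact: le_trans tx.
  have exg : v x = u (g 0) by rewrite ex g0.
  have e1g : v 1 = u (g (last 0 s)) by rewrite ls g1 v1.
  have [s' [ps' ls' les']] := chain_le (lexx 0) ps ls1 x0 x1 (lexx 1) exg e1g.
  apply: (@le_trans _ _ (chain_length g' 0 (tau :: x :: s'))%:E); last first.
    by apply: chain_length_le_curve_length; rewrite /= ?t0 ?tx ?ps' ?ls'.
  rewrite lee_fin /= addrC; apply: lerD.
    apply: le_trans (dist_ge_u C0 Ct).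
    by rewrite -/(v 0) -/(v tau) v0 distrC ger0_norm // subr_ge0 ltW.
  by rewrite -[leLHS]add0r lerD // sqrtr_ge0.
rewrite ltr0_norm // in uv *.
have [x /andP[x0 xt] ex] : exists2 x, 0 <= x <= tau & v x = - u0.
  by apply: ivt => //; rewrite -/(v _) -/(v _) v0; apply/andP; split; lra.
have x1 : x <= 1 by exact: le_trans t1.
have e0g : v 0 = u (g 0) by rewrite v0 g0.
have exg : v x = u (g (last 0 s)) by rewrite ls g1 ex.
have [s' [ps' ls' les']] := chain_le (lexx 0) ps ls1 (lexx 0) x0 x1 e0g exg.
apply: (@le_trans _ _ (chain_length g' 0 (s' ++ [:: tau; 1]))%:E); last first.
  apply: chain_length_le_curve_length; rewrite ?last_cat //.
  by rewrite cat_path ps' ls' /= xt t1.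
rewrite lee_fin chain_length_cat; apply: lerD => //=.
rewrite addr0; apply: le_trans (_ : euclidean_dist (g' tau) (g' 1) <= _).
  apply: le_trans (dist_ge_u Ct C1); rewrite -/(v 1) -/(v tau) v1 opprK.
  by rewrite -normrN ger0_norm; lra.
by rewrite lerDr sqrtr_ge0.
Qed.

(** Without overshoot z^2 >= mu > 0, so z keeps the positive sign it has at the start. The arc then
    stays on the graph, and covers all of it by the intermediate value theorem. *)
Let exists_overshoot : g' @` `[0, 1] <> conic_graph @` [set x | `|x| <= u0] ->
  exists2 tau, 0 <= tau <= 1 & u0 < `|v tau|.
Proof.
move=> img; apply: contrapT => no_overshoot; apply: img.
have vb tau : 0 <= tau <= 1 -> `|v tau| <= u0.
  by move=> ht; rewrite leNgt; apply/negP => ?; apply: no_overshoot; exists tau.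
have z_neq0 tau : 0 <= tau <= 1 -> (g' tau).2 != 0.
  move=> ht; rewrite -sqrf_eq0; have [-> _] := C' ht.
  by rewrite gt_eqF // f_gt0 // vb.
have z_gt0 tau : 0 <= tau <= 1 -> 0 < (g' tau).2.
  move=> /andP[t0 t1]; rewrite ltNge; apply/negP => zt.
  have z0 : 0 <= (g' 0).2.
    by case: arc' => _ _ _ -> _; rewrite swap_if_2 sqrtr_ge0.
  have cz : continuous (fun p : space3 R => p.2) by move=> p; exact: cvg_snd.
  have [|y /andP[y0 yt] /eqP] := ivt cz (lexx 0) t0 t1 (w := 0); first by rewrite zt.
  by apply/negP/z_neq0; rewrite y0 (le_trans yt).
have gE tau : 0 <= tau <= 1 -> g' tau = conic_graph (v tau).
  move=> ht; apply: axis_conic_ext; first exact: C'.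
  - by apply: conic_graph_in; exact: vb.
  - by rewrite u_conic_graph.
  have [z2 _] := C' ht; rewrite swap_if_2 /= -z2 sqrtr_sqr gtr0_norm //.
  exact: z_gt0.
apply/seteqP; split=> p /=.
  move=> [tau]; rewrite in_itv /= => ht <-.
  by exists (v tau); [exact: vb|rewrite gE].
move=> [x]; rewrite ler_norml => /andP[x1 x2] <-.
have [|tau ht ex] := ivt cu (lexx 0) ler01 (lexx 1) (w := x).
  by rewrite -/(v _) -/(v _) v0 v1 x1 x2.
by exists tau; [rewrite in_itv|rewrite gE // /v ex].
Qed.

Lemma other_arc_longer : g' @` `[0, 1] <> conic_graph @` [set x | `|x| <= u0] ->
  (curve_length 0 1 g < curve_length 0 1 g')%E.
Proof. by move=> /exists_overshoot[tau]; exact: overshoot_longer. Qed.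

End OtherArc.

Lemma conic_graph_shorter_arc :
  is_shorter_arc axis_conic (conic_graph u0) (conic_graph (- u0))
    (conic_graph @` [set x | `|x| <= u0]).
Proof.
have img : g @` `[0, 1] = conic_graph @` [set x | `|x| <= u0].
  apply/seteqP; split=> p /=.
    move=> [tau]; rewrite in_itv /= => ht <-.
    by exists (u0 * (1 - 2 * tau)); [exact: g_bound|].
  move=> [x]; rewrite ler_norml => /andP[x1 x2] <-.
  exists ((1 - x / u0) / 2); last first.
    by rewrite /g; congr conic_graph; field; exact: lt0r_neq0.
  have xu1 : x / u0 <= 1 by rewrite ler_pdivrMr // mul1r.
  have xu2 : -1 <= x / u0 by rewrite ler_pdivlMr // mulN1r.
  by rewrite in_itv /=; apply/andP; split; lra.
exists g; split=> //; last by move=> g' arc'; exact: other_arc_longer.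
split.
- apply: continuous_subspaceT => t.
  have cx : {for t, continuous (fun t : R => u0 * (1 - 2 * t))}.
    by apply: smooth_near_continuous; smooth.
  have cf : {for t, continuous (fun t : R => P + Q * (u0 * (1 - 2 * t)) ^+ 2)}.
    by apply: smooth_near_continuous; smooth.
  have cz : {for t, continuous (fun t : R => Num.sqrt (P + Q * (u0 * (1 - 2 * t)) ^+ 2))}.
    apply: (@continuous_comp _ _ _ _ (@Num.sqrt R) t cf).
    exact: sqrt_continuous.
  have c0 : {for t, continuous (fun _ : R => 0 : R)} by exact: cst_continuous.
  rewrite /g /conic_graph /swap_if; case: (sw).
    exact: (cvg_pair (cvg_pair c0 cx) cz).
  exact: (cvg_pair (cvg_pair cx c0) cz).
- move=> x y _ _ /(congr1 u); rewrite !u_conic_graph.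
  move=> /(mulfI (lt0r_neq0 u0_gt0)); lra.
- by move=> y [tau]; rewrite /= in_itv /= => ht <-; exact: g_conic.
- by rewrite /g mulr0 subr0 mulr1.
- by rewrite /g; congr conic_graph; ring.
Qed.
End ConicArcs.

(** * Points of the surface *)

Section CirclePoints.
Variable R : realType.
Implicit Types C S t : R.

Lemma circle_angle C S : C ^+ 2 + S ^+ 2 = 1 ->
  exists2 t, 0 <= t < 2 * pi & cos t = C /\ sin t = S.
Proof.
move=> CS; have C1 : -1 <= C <= 1 by apply/andP; split; nra.
have Cin : C \in `[-1, 1] by rewrite in_itv.
have sinC : sin (acos C) = `|S| by rewrite sin_acos // -sqrtr_sqr -CS addrAC subrr add0r.
have t0 := acos_ge0 C1; have tpi := acos_lepi C1; have pi0 := pi_gt0 R.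
have [S0|S0] := leP 0 S.
  exists (acos C); first by apply/andP; split; lra.
  by rewrite acosK // sinC ger0_norm.
exists (2 * pi - acos C).
  have : acos C != 0.
    apply/eqP => e; move: sinC; rewrite e sin0 => /esym/eqP.
    by rewrite normr_eq0 lt_eqF.
  by rewrite neq_lt ltNge t0 /= => ?; apply/andP; split; lra.
have e2 : 2 * pi = pi *+ 2 :> R by rewrite mulr2n; ring.
rewrite e2 cosB sinB cos2pi sin2pi acosK // sinC ltr0_norm //; split; ring.
Qed.

(** Half the difference of the angles lies in [0, pi[ and has sine 0. *)
Lemma circle_angle_inj t t' : 0 <= t < 2 * pi -> 0 <= t' < 2 * pi ->
  cos t = cos t' -> sin t = sin t' -> t = t'.
Proof.
wlog le_tt : t t' / t <= t'.
  move=> H ht ht' ec es; have [|/ltW] := leP t t'; first by move/H; apply.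
  by move=> le_tt; apply/esym/H.
move=> /andP[t0 t1] /andP[t'0 t'1] ec es.
have c1 : cos (2 * ((t' - t) / 2)) = 1.
  have -> : 2 * ((t' - t) / 2) = t' - t by field.
  by rewrite cosB ec es -!expr2 cos2Dsin2.
have s0 : sin ((t' - t) / 2) = 0.
  by apply/eqP; rewrite -sqrf_eq0; apply/eqP; move: c1; rewrite cos_double; lra.
apply/eqP; rewrite eq_le le_tt /=; rewrite leNgt; apply/negP => lt_tt.
have : 0 < sin ((t' - t) / 2) by apply: sin_gt0_pi; apply/andP; split; lra.
by rewrite s0 ltxx.
Qed.

End CirclePoints.

Section SignedRoot.
Variable R : realType.
Implicit Types v : R.

(** [Num.sqrt] is 0 on negative numbers, so this is sgn v times the root of |v|, in a form whose
    continuity at 0 is immediate. It inverts v |-> v |v|. *)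
Definition signed_sqrt v : R := Num.sqrt v - Num.sqrt (- v).

Lemma signed_sqrt_ge0 v : 0 <= v -> signed_sqrt v = Num.sqrt v.
Proof. by move=> v0; rewrite /signed_sqrt (ler0_sqrtr (a := - v)) ?subr0 ?oppr_le0. Qed.

Lemma signed_sqrtN v : signed_sqrt (- v) = - signed_sqrt v.
Proof. by rewrite /signed_sqrt opprK opprB. Qed.

Lemma sqr_signed_sqrt v : signed_sqrt v ^+ 2 = `|v|.
Proof.
have [v0|/ltW v0] := leP 0 v; first by rewrite signed_sqrt_ge0 // sqr_sqrtr // ger0_norm.
rewrite -{1}[v]opprK signed_sqrtN sqrrN signed_sqrt_ge0 ?oppr_ge0 //.
by rewrite sqr_sqrtr ?oppr_ge0 // ler0_norm.
Qed.

Lemma signed_sqrtK v : signed_sqrt v * `|signed_sqrt v| = v.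
Proof.
wlog v0 : v / 0 <= v => [H|].
  have [/H //|/ltW v0] := leP 0 v.
  by apply: oppr_inj; rewrite -mulNr -(normrN (signed_sqrt v)) -signed_sqrtN H ?oppr_ge0.
by rewrite signed_sqrt_ge0 // ger0_norm ?sqrtr_ge0 // -expr2 sqr_sqrtr.
Qed.

Lemma signed_sqr_sqrt v : signed_sqrt (v * `|v|) = v.
Proof.
wlog v0 : v / 0 <= v => [H|].
  have [/H //|/ltW v0] := leP 0 v.
  by apply: oppr_inj; rewrite -signed_sqrtN -mulNr -normrN H ?oppr_ge0.
by rewrite ger0_norm // signed_sqrt_ge0 ?mulr_ge0 // -expr2 sqrtr_sqr ger0_norm.
Qed.

Lemma signed_sqrt_continuous : continuous signed_sqrt.
Proof.
move=> v; have cN : {for v, continuous (fun x : R => - x)}.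
  by apply: smooth_near_continuous; smooth.
have csN := @continuous_comp _ _ _ _ (@Num.sqrt R) v cN (@sqrt_continuous R (- v)).
exact: (cvgB (@sqrt_continuous R v) csN).
Qed.

End SignedRoot.

Section SurfacePoints.
Variables (R : realType) (a b c : R).

(** A point of the unit circle replaces the angle, which avoids the jump at 2 pi. *)
Definition surface_point (l C S : R) : space3 R :=
  ((a - l) / Num.sqrt (a + c) * C, (b - l) / Num.sqrt (b + c) * S,
   (c + l) * Num.sqrt (C ^+ 2 / (a + c) + S ^+ 2 / (b + c))).

Lemma sigma_plusE (u : plane R) :
  sigma_plus a b c u = surface_point u.1 (cos u.2) (sin u.2).
Proof. by []. Qed.

Hypotheses (hab : b < a) (hb : 0 < b) (hc : 0 < c).

Let ac0 : 0 < a + c. Proof. by rewrite addr_gt0 // (lt_trans hb). Qed.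
Let bc0 : 0 < b + c. Proof. by rewrite addr_gt0. Qed.
Let A0 : 0 < Num.sqrt (a + c). Proof. by rewrite sqrtr_gt0. Qed.
Let B0 : 0 < Num.sqrt (b + c). Proof. by rewrite sqrtr_gt0. Qed.
Let ab0 : a - b != 0. Proof. by rewrite subr_eq0 gt_eqF. Qed.

(* Both squared points determine the same cubic, with double root [l] resp.
   [l'], and a cubic has at most one double root. *)
Lemma surface_point_parameter l C S l' C' S' :
  C ^+ 2 + S ^+ 2 = 1 -> C' ^+ 2 + S' ^+ 2 = 1 ->
  surface_point l C S = surface_point l' C' S' -> l = l'.
Proof.
move=> CS CS' e; have nab : a != b by rewrite gt_eqF.
have [t _ [ct st]] := circle_angle CS; have [t' _ [ct' st']] := circle_angle CS'.
have ee : sigma_plus a b c (l, t) = sigma_plus a b c (l', t').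
  by rewrite !sigma_plusE /= ct st ct' st'.
have ex := sigma_plus_sqx b ac0 (l, t).
have ey := sigma_plus_sqy a bc0 (l, t).
have ez := sigma_plus_sqz ac0 bc0 (l, t).
rewrite ee sigma_plus_sqx // in ex; rewrite ee sigma_plus_sqy // in ey.
rewrite ee sigma_plus_sqz // in ez.
have h1 := cubic_e1_surface ac0 bc0 l (sin t ^+ 2).
have h2 := cubic_e2_surface ac0 bc0 l (sin t ^+ 2).
have h3 := cubic_e3_surface ac0 bc0 l (sin t ^+ 2).
rewrite /= in ex ey ez.
rewrite -ex -ey -ez cubic_e1_surface // in h1.
rewrite -ex -ey -ez cubic_e2_surface // in h2.
rewrite -ex -ey -ez cubic_e3_surface // in h3.
move: h1 h2 h3; set m := b + _ * sin t ^+ 2; set m' := b + _ * sin t' ^+ 2.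
move=> h1 h2 h3.
have cub L : (L - l) ^+ 2 * (L - m) = (L - l') ^+ 2 * (L - m').
  transitivity (L ^+ 3 - (2 * l + m) * L ^+ 2 + (l ^+ 2 + 2 * l * m) * L - l ^+ 2 * m).
    by ring.
  by rewrite -h1 -h2 -h3; ring.
apply/eqP; apply: contraT => nll.
(* If l and l' differ, each must be the simple root of the other factorisation: m' = l and m = l'.
   The sums of the roots then give 2l + l' = 2l' + l. *)
have m'l : m' = l.
  have /esym/eqP := cub l; rewrite subrr expr0n mul0r mulf_eq0 expf_eq0 /=.
  by rewrite !subr_eq0 (negbTE nll) /= => /eqP.
have ml' : m = l'.
  have /eqP := cub l'; rewrite subrr expr0n mul0r mulf_eq0 expf_eq0 /=.
  by rewrite !subr_eq0 eq_sym (negbTE nll) /= => /eqP.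
by move: nll; rewrite m'l ml' in h1; have -> : l = l' by [lra]; rewrite eqxx.
Qed.

Lemma surface_point_cos l C S C' S' : l != a ->
  surface_point l C S = surface_point l C' S' -> C = C'.
Proof.
move=> la [/mulfI e _ _]; apply: e; apply: mulf_neq0; first by rewrite subr_eq0 eq_sym.
by rewrite invr_eq0 lt0r_neq0.
Qed.

Lemma surface_point_sin l C S C' S' : l != b ->
  surface_point l C S = surface_point l C' S' -> S = S'.
Proof.
move=> lb [_ /mulfI e _]; apply: e; apply: mulf_neq0; first by rewrite subr_eq0 eq_sym.
by rewrite invr_eq0 lt0r_neq0.
Qed.

(** At l = a the factor b - l is negative, so V_3, with y > 0, has sine - 1. This is the origin of
    the minus signs on Y and S below. *)
Lemma vertexE (i : 'I_4) : vertex a b c i =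
  nth (0, 0, 0) [:: surface_point b 1 0; surface_point b (- 1) 0;
                    surface_point a 0 (- 1); surface_point a 0 1] i.
Proof.
have sA : Num.sqrt (1 / (a + c)) = (Num.sqrt (a + c))^-1.
  by rewrite mul1r sqrtrV // ltW.
have sB : Num.sqrt (1 / (b + c)) = (Num.sqrt (b + c))^-1.
  by rewrite mul1r sqrtrV // ltW.
rewrite /vertex /surface_point !sqrrN !expr1n !expr0n /= !mul0r !addr0 !add0r sA sB.
rewrite !mulr0 !mulr1 !mulrN !mulr1 (addrC c a) (addrC c b) -(opprB a b) !mulNr opprK.
by case: i => [[|[|[|[|//]]]] hi].
Qed.

Lemma conic_xzE :
  conic_xz a b c = axis_conic false (c + b) (- (c + b) / (a - b)).
Proof.
have cb0 : c + b != 0 by rewrite addrC lt0r_neq0.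
apply/seteqP; split=> -[[x y] z] [/= e y0]; split=> //=.
  have ez : z ^+ 2 / (c + b) = 1 - x ^+ 2 / (a - b) by rewrite -e; ring.
  by rewrite -[z ^+ 2](divfK cb0) ez; field.
by rewrite e; field; rewrite ?ab0 ?cb0.
Qed.

Lemma conic_yzE :
  conic_yz a b c = axis_conic true (c + a) ((c + a) / (a - b)).
Proof.
have ca0 : c + a != 0 by rewrite addrC lt0r_neq0.
apply/seteqP; split=> -[[x y] z] [/= e x0]; split=> //=.
  have ez : z ^+ 2 / (c + a) = 1 + y ^+ 2 / (a - b) by rewrite -e; ring.
  by rewrite -[z ^+ 2](divfK ca0) ez; field.
by rewrite e; field; rewrite ?ab0 ?ca0.
Qed.

Lemma surface_point_xz C S : C ^+ 2 + S ^+ 2 = 1 -> surface_point b C S =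
  conic_graph false (c + b) (- (c + b) / (a - b)) ((a - b) / Num.sqrt (a + c) * C).
Proof.
move=> CS; rewrite /conic_graph /surface_point /= subrr !mul0r.
congr (_, _, _).
have cb : 0 <= c + b by rewrite addrC ltW.
rewrite -[X in X * _](ger0_norm cb) -sqrtr_sqr -sqrtrM ?sqr_ge0 //; congr Num.sqrt.
rewrite !exprMn exprVn sqr_sqrtr ?(ltW ac0) //.
have -> : S ^+ 2 = 1 - C ^+ 2 by rewrite -CS; ring.
by field; rewrite ab0 !lt0r_neq0.
Qed.

Lemma surface_point_yz C S : C ^+ 2 + S ^+ 2 = 1 -> surface_point a C S =
  conic_graph true (c + a) ((c + a) / (a - b)) ((a - b) / Num.sqrt (b + c) * - S).
Proof.
move=> CS; rewrite /conic_graph /surface_point /= subrr !mul0r.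
congr (_, _, _); first by rewrite -(opprB a b) !mulNr mulrN.
have ca : 0 <= c + a by rewrite addrC ltW.
rewrite -[X in X * _](ger0_norm ca) -sqrtr_sqr -sqrtrM ?sqr_ge0 //; congr Num.sqrt.
rewrite mulrN sqrrN !exprMn exprVn sqr_sqrtr ?(ltW bc0) //.
have -> : C ^+ 2 = 1 - S ^+ 2 by rewrite -CS; ring.
by field; rewrite ab0 !lt0r_neq0.
Qed.

End SurfacePoints.

(** * The tetrahedron *)

Lemma ord4P (i : 'I_4) : [\/ i = 0, i = 1, i = 2 | i = 3].
Proof.
case: i => [[|[|[|[|//]]]] hi];
  by [apply: Or41; exact: val_inj|apply: Or42; exact: val_inj
     |apply: Or43; exact: val_inj|apply: Or44; exact: val_inj].
Qed.

Section TetrahedronCoordinates.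
Variable R : realType.
Implicit Types (s : 'rV[R]_4) (X Y q : R).

(* The tetrahedron with vertices (1,0,0), (-1,0,0), (0,1,1), (0,-1,1) in the
   coordinates (X, Y, q); its slice at height [q] is the rectangle
   |X| <= 1 - q, |Y| <= q. *)
Definition tetX s := s 0 0 - s 0 1.
Definition tetY s := s 0 2 - s 0 3.
Definition tetq s := s 0 2 + s 0 3.
Definition tet_point X Y q : 'rV[R]_4 :=
  \row_i nth 0 [:: (1 - q + X) / 2; (1 - q - X) / 2; (q + Y) / 2; (q - Y) / 2] i.

Lemma tetX_point X Y q : tetX (tet_point X Y q) = X.
Proof. by rewrite /tetX !mxE /=; field. Qed.

Lemma tetY_point X Y q : tetY (tet_point X Y q) = Y.
Proof. by rewrite /tetY !mxE /=; field. Qed.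

Lemma tetq_point X Y q : tetq (tet_point X Y q) = q.
Proof. by rewrite /tetq !mxE /=; field. Qed.

Lemma sum_row4 s : \sum_i s 0 i = s 0 0 + s 0 1 + s 0 2 + s 0 3.
Proof.
rewrite !big_ord_recl big_ord0 addr0 !addrA.
by congr (_ + _ + _ + _); congr (s 0 _); exact: val_inj.
Qed.

Lemma simplex3P s : simplex3 s ->
  [/\ s 0 0 + s 0 1 = 1 - tetq s, `|tetX s| <= 1 - tetq s & `|tetY s| <= tetq s].
Proof.
move=> [s0]; rewrite sum_row4 => s1; rewrite /tetq /tetX /tetY.
have h0 := s0 0; have h1 := s0 1; have h2 := s0 2; have h3 := s0 3.
by split; rewrite ?ler_norml; lra.
Qed.

Lemma tet_pointK s : simplex3 s -> s = tet_point (tetX s) (tetY s) (tetq s).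
Proof.
move=> [_]; rewrite sum_row4 => s1; apply/rowP => i; rewrite mxE /tetX /tetY /tetq.
by case: (ord4P i) => -> /=; lra.
Qed.

(** The first two barycentric coordinates have sum 1 - q and difference X, so one of them vanishes
    exactly when |X| = 1 - q; likewise for the last two with q and Y. *)
Lemma tetrahedron_surfaceP s : tetrahedron_surface s ->
  `|tetX s| = 1 - tetq s \/ `|tetY s| = tetq s.
Proof.
move=> [[s0 +] [i]]; rewrite sum_row4 => s1; rewrite /tetq /tetX /tetY.
have h0 := s0 0; have h1 := s0 1; have h2 := s0 2; have h3 := s0 3.
case: (ord4P i) => -> si; rewrite si in s1 *.
- by left; rewrite sub0r normrN ger0_norm //; lra.
- by left; rewrite subr0 ger0_norm //; lra.
- by right; rewrite sub0r normrN ger0_norm // add0r.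
- by right; rewrite subr0 ger0_norm // addr0.
Qed.

Lemma tet_point_surface X Y q : `|X| <= 1 - q -> `|Y| <= q ->
  `|X| = 1 - q \/ `|Y| = q -> tetrahedron_surface (tet_point X Y q).
Proof.
move=> hX hY h; split; first split.
- move=> i; rewrite mxE; move: hX hY; rewrite !ler_norml => /andP[? ?] /andP[? ?].
  by case: (ord4P i) => -> /=; lra.
- by rewrite sum_row4 !mxE /=; field.
case: h => e.
  have [X0|X0] := leP 0 X.
    by exists 1; rewrite mxE /=; move: e; rewrite ger0_norm //; lra.
  by exists 0; rewrite mxE /=; move: e; rewrite ltr0_norm //; lra.
have [Y0|Y0] := leP 0 Y.
  by exists 3; rewrite mxE /=; move: e; rewrite ger0_norm //; lra.
by exists 2; rewrite mxE /=; move: e; rewrite ltr0_norm //; lra.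
Qed.

Lemma tetrahedron_edge_surface i j s :
  tetrahedron_edge i j s -> tetrahedron_surface s.
Proof.
move=> [hs hk]; split=> //.
have [k /andP[ki kj]] : exists k : 'I_4, (k != i) && (k != j).
  by case: (ord4P i) => ->; case: (ord4P j) => ->;
    by [exists 0|exists 1|exists 2|exists 3].
by exists k; apply: hk.
Qed.

Lemma tetrahedron_edge01P s : tetrahedron_edge 0 1 s <->
  tetrahedron_surface s /\ tetq s = 0.
Proof.
split=> [hs|[[hs _] q0]].
  split; first exact: tetrahedron_edge_surface hs.
  by case: hs => _ h; rewrite /tetq !h ?addr0.
split=> // k k0 k1; have [h _] := hs; have h2 := h 2; have h3 := h 3.
by move: q0; rewrite /tetq; case: (ord4P k) k0 k1 => -> // _ _; lra.
Qed.

Lemma tetrahedron_edge23P s : tetrahedron_edge 2 3 s <->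
  tetrahedron_surface s /\ tetq s = 1.
Proof.
split=> [hs|[[hs _] q1]].
  split; first exact: tetrahedron_edge_surface hs.
  by case: hs => -[_ +] h; rewrite sum_row4 !(h 0, h 1) // !add0r.
split=> // k k2 k3; have [h +] := hs; rewrite sum_row4.
have h0 := h 0; have h1 := h 1.
by move: q1; rewrite /tetq; case: (ord4P k) k2 k3 => -> // _ _; lra.
Qed.

(** The four mixed edges trace the corners of the rectangular slices. *)
Lemma tetrahedron_edge_mixed s : tetrahedron_surface s ->
  (exists i j : 'I_4, (i < 2 <= j)%N /\ tetrahedron_edge i j s) <->
  `|tetX s| = 1 - tetq s /\ `|tetY s| = tetq s.
Proof.
move=> hsurf; have [hs _] := hsurf; have [e _ _] := simplex3P hs; have [h _] := hs.
have h0 := h 0; have h1 := h 1; have h2 := h 2; have h3 := h 3.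
rewrite /tetX /tetY /tetq in e *; split.
  move=> [i [j [/andP[i2 j2] [_ hk]]]]; rewrite -e; split.
    case: (ord4P i) i2 hk => -> // _ hk.
      rewrite (hk 1) //; last by case: (ord4P j) j2 => ->.
      by rewrite subr0 addr0 ger0_norm.
    rewrite (hk 0) //; last by case: (ord4P j) j2 => ->.
    by rewrite sub0r add0r normrN ger0_norm.
  case: (ord4P j) j2 hk => -> // _ hk.
    rewrite (hk 3) //; last by case: (ord4P i) i2 => ->.
    by rewrite subr0 addr0 ger0_norm.
  rewrite (hk 2) //; last by case: (ord4P i) i2 => ->.
  by rewrite sub0r add0r normrN ger0_norm.
rewrite -e => -[eX eY].
have [i i2 hi] : exists2 i : 'I_4, (i < 2)%N &
    forall k : 'I_4, (k < 2)%N -> k != i -> s 0 k = 0.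
  have [X0|X0] := leP 0 (s 0 0 - s 0 1).
    exists 0 => // k; case: (ord4P k) => -> // _ _.
    by move: eX; rewrite ger0_norm //; lra.
  exists 1 => // k; case: (ord4P k) => -> // _ _.
  by move: eX; rewrite ltr0_norm //; lra.
have [j j2 hj] : exists2 j : 'I_4, (2 <= j)%N &
    forall k : 'I_4, (2 <= k)%N -> k != j -> s 0 k = 0.
  have [Y0|Y0] := leP 0 (s 0 2 - s 0 3).
    exists 2 => // k; case: (ord4P k) => -> // _ _.
    by move: eY; rewrite ger0_norm //; lra.
  exists 3 => // k; case: (ord4P k) => -> // _ _.
  by move: eY; rewrite ltr0_norm //; lra.
exists i, j; split; first by rewrite i2.
by split=> // k ki kj; have [k2|k2] := ltnP k 2; [exact: hi|exact: hj].
Qed.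

Lemma tetrahedron_edge_vertex i j s : i != j -> tetrahedron_edge i j s ->
  s 0 i = 0 -> s = delta_mx 0 j.
Proof.
move=> ij [[_ s1] h] si; apply/rowP => k; rewrite mxE eqxx /=.
rewrite (bigD1 j) //= big1 ?addr0 in s1; last first.
  by move=> l lj; have [->//|li] := eqVneq l i; exact: h.
have [->//|kj] := eqVneq k j; have [->//|ki] := eqVneq k i; exact: h.
Qed.

End TetrahedronCoordinates.

(** * The homeomorphism from the tetrahedron onto the surface *)

Section TetrahedronMap.
Variables (R : realType) (a b c : R).
Hypotheses (hab : b < a) (hb : 0 < b) (hc : 0 < c).
Implicit Types (s : 'rV[R]_4) (X Y q : R).

Let ac0 : 0 < a + c. Proof. by rewrite addr_gt0 // (lt_trans hb). Qed.
Let bc0 : 0 < b + c. Proof. by rewrite addr_gt0. Qed.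
Let A0 : 0 < Num.sqrt (a + c). Proof. by rewrite sqrtr_gt0. Qed.
Let B0 : 0 < Num.sqrt (b + c). Proof. by rewrite sqrtr_gt0. Qed.
Let ab0 : a - b != 0. Proof. by rewrite subr_eq0 gt_eqF. Qed.

Definition tet_lambda q := b + (a - b) * q.

(* On the faces [|Y| = q] this is [surface_point] with [cos t = signed_sqrt X],
   on the faces [|X| = 1 - q] with [sin t = - signed_sqrt Y]. *)
Definition tet_map s : space3 R :=
  let X := tetX s in let Y := tetY s in let q := tetq s in
  ((a - b) / Num.sqrt (a + c) * (signed_sqrt X * Num.sqrt ((1 - q) * (1 - `|Y|))),
   (a - b) / Num.sqrt (b + c) * (signed_sqrt Y * Num.sqrt (q * (1 - `|X|))),
   (c + tet_lambda q) * Num.sqrt ((`|X| + q - `|Y|) / (a + c) +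
                                  (1 - (`|X| + q - `|Y|)) / (b + c))).

(** Since a - l = (a - b)(1 - q) and b - l = - (a - b) q, the first two coordinates only involve (1
    - q) C and q S; in this form q = 0 and q = 1 need no separate treatment. *)
Lemma tet_map_surface_point s C S : C ^+ 2 + S ^+ 2 = 1 ->
  C ^+ 2 = `|tetX s| + tetq s - `|tetY s| ->
  (1 - tetq s) * C = signed_sqrt (tetX s) * Num.sqrt ((1 - tetq s) * (1 - `|tetY s|)) ->
  tetq s * S = - (signed_sqrt (tetY s) * Num.sqrt (tetq s * (1 - `|tetX s|))) ->
  tet_map s = surface_point a b c (tet_lambda (tetq s)) C S.
Proof.
move=> CS C2 eC eS; rewrite /tet_map -C2 -eC.
have -> : 1 - C ^+ 2 = S ^+ 2 by rewrite -CS; ring.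
rewrite -[signed_sqrt (tetY s) * _]opprK -eS /surface_point /tet_lambda.
by congr (_, _, _); field; exact: lt0r_neq0.
Qed.

(** Unlike [Num.sg], it is 1 at 0: for q = 1 one has X = 0, yet C must still be a root of 1 - |Y|,
    and both roots give the same point. The same holds for Y and S when q = 0. *)
Let sg X : R := if 0 <= X then 1 else -1.

Let sg2 X : sg X ^+ 2 = 1.
Proof. by rewrite /sg; case: ifP; rewrite ?sqrrN expr1n. Qed.

Let sg_sqrt X : signed_sqrt X = sg X * Num.sqrt `|X|.
Proof.
rewrite /sg; case: (leP 0 X) => [X0|X0].
  by rewrite mul1r signed_sqrt_ge0 // ger0_norm.
by rewrite mulN1r -{1}[X]opprK signed_sqrtN signed_sqrt_ge0 ?oppr_ge0 ?ltr0_norm // ltW.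
Qed.

(** The expression |X| + q - |Y| is 1 - |Y| on the faces |X| = 1 - q and |X| on the faces |Y| = q;
    in both cases it is cos^2 t. *)
Lemma tet_mapP s : tetrahedron_surface s -> exists C S,
  [/\ C ^+ 2 + S ^+ 2 = 1, C ^+ 2 = `|tetX s| + tetq s - `|tetY s| &
      tet_map s = surface_point a b c (tet_lambda (tetq s)) C S].
Proof.
move=> hsurf; have [hs _] := hsurf; have [_ hX hY] := simplex3P hs.
have q0 : 0 <= tetq s by exact: le_trans hY.
have q1 : 0 <= 1 - tetq s by exact: le_trans hX.
have X1 : 0 <= 1 - `|tetX s| by lra.
have Y1 : 0 <= 1 - `|tetY s| by lra.
have sqrtrr v : 0 <= v -> Num.sqrt (v * v) = v.
  by move=> v0; rewrite -expr2 sqrtr_sqr ger0_norm.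
have [e|e] := tetrahedron_surfaceP hsurf.
  pose S := - signed_sqrt (tetY s); pose C := sg (tetX s) * Num.sqrt (1 - `|tetY s|).
  have C2 : C ^+ 2 = 1 - `|tetY s| by rewrite exprMn sg2 mul1r sqr_sqrtr.
  have S2 : S ^+ 2 = `|tetY s| by rewrite sqrrN sqr_signed_sqrt.
  have CS : C ^+ 2 + S ^+ 2 = 1 by rewrite C2 S2 subrK.
  have C2' : C ^+ 2 = `|tetX s| + tetq s - `|tetY s| by rewrite C2 e subrK.
  exists C, S; split=> //; apply: tet_map_surface_point => //.
    rewrite sg_sqrt e sqrtrM // /C.
    transitivity (sg (tetX s) * Num.sqrt (1 - tetq s) ^+ 2 * Num.sqrt (1 - `|tetY s|)).
      by rewrite sqr_sqrtr //; ring.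
    by ring.
  have -> : 1 - `|tetX s| = tetq s by rewrite e; ring.
  by rewrite sqrtrr // /S; ring.
pose C := signed_sqrt (tetX s); pose S := - (sg (tetY s) * Num.sqrt (1 - `|tetX s|)).
have S2 : S ^+ 2 = 1 - `|tetX s| by rewrite sqrrN exprMn sg2 mul1r sqr_sqrtr.
have C2 : C ^+ 2 = `|tetX s| by rewrite sqr_signed_sqrt.
have CS : C ^+ 2 + S ^+ 2 = 1 by rewrite C2 S2 addrC subrK.
have C2' : C ^+ 2 = `|tetX s| + tetq s - `|tetY s| by rewrite C2 e addrK.
exists C, S; split=> //; apply: tet_map_surface_point => //.
  by rewrite e sqrtrr // /C; ring.
rewrite sg_sqrt e sqrtrM // /S.
transitivity (- (sg (tetY s) * Num.sqrt (tetq s) ^+ 2 * Num.sqrt (1 - `|tetX s|))).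
  by rewrite sqr_sqrtr //; ring.
by ring.
Qed.

Lemma tet_map_onto q C S : 0 <= q <= 1 -> C ^+ 2 + S ^+ 2 = 1 ->
  exists s, [/\ tetrahedron_surface s, tetq s = q &
    tet_map s = surface_point a b c (tet_lambda q) C S].
Proof.
move=> /andP[q0 q1] CS; have q1' : 0 <= 1 - q by rewrite subr_ge0.
have sqrtrr (v : R) : 0 <= v -> Num.sqrt (v * v) = v.
  by move=> v0; rewrite -expr2 sqrtr_sqr ger0_norm.
have nsq (v : R) : `|v * `|v| | = v ^+ 2.
  by rewrite normrM normr_id -expr2 real_normK ?num_real.
have nsg (v w : R) : 0 <= w -> `|sg v * w| = w.
  by move=> w0; rewrite normrM (ger0_norm w0) /sg; case: ifP; rewrite ?normrN normr1 mul1r.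
have sgn (v : R) : sg v * `|v| = v.
  rewrite /sg; case: (leP 0 v) => v0; first by rewrite mul1r ger0_norm.
  by rewrite mulN1r ltr0_norm // opprK.
have ssg (v w : R) : 0 <= w -> signed_sqrt (sg v * w) = sg v * Num.sqrt w.
  move=> w0; rewrite /sg; case: ifP => _; first by rewrite !mul1r signed_sqrt_ge0.
  by rewrite !mulN1r signed_sqrtN signed_sqrt_ge0.
have C2 : C ^+ 2 = 1 - S ^+ 2 by rewrite -CS; ring.
have S2 : S ^+ 2 = 1 - C ^+ 2 by rewrite -CS; ring.
have S0 := sqr_ge0 S; have C0 := sqr_ge0 C.
(* The sides of the rectangle change at C^2 = 1 - q, that is S^2 = q or l = m. Below that value X =
   C |C| is kept and Y is pushed to q or - q; above it Y is kept. *)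
have [Cq|Cq] := leP (C ^+ 2) (1 - q).
  exists (tet_point (C * `|C|) (sg (- S) * q) q); rewrite tetq_point; split=> //.
    by apply: tet_point_surface; rewrite ?nsq ?nsg //; right.
  have := @tet_map_surface_point (tet_point (C * `|C|) (sg (- S) * q) q) C S CS.
  rewrite tetX_point tetY_point tetq_point nsq nsg //; apply.
  - by rewrite addrK.
  - by rewrite signed_sqr_sqrt sqrtrr // mulrC.
  rewrite ssg // -S2 sqrtrM // sqrtr_sqr -{1}[S]opprK -{1}(sgn (- S)) normrN.
  transitivity (- (sg (- S) * Num.sqrt q ^+ 2 * `|S|)); last by ring.
  by rewrite sqr_sqrtr //; ring.
have Sq : S ^+ 2 <= q by lra.
exists (tet_point (sg C * (1 - q)) (- S * `|- S|) q); rewrite tetq_point; split=> //.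
  by apply: tet_point_surface; rewrite ?nsq ?nsg ?sqrrN //; left.
have := @tet_map_surface_point (tet_point (sg C * (1 - q)) (- S * `|- S|) q) C S CS.
rewrite tetX_point tetY_point tetq_point nsq nsg // ?sqrrN; apply.
- by rewrite subrK.
- rewrite ssg // -C2 sqrtrM // sqrtr_sqr -{1}(sgn C).
  transitivity (sg C * Num.sqrt (1 - q) ^+ 2 * `|C|); last by ring.
  by rewrite sqr_sqrtr //; ring.
rewrite signed_sqr_sqrt subKr sqrtrr //; ring.
Qed.

(** The common factor can only vanish for r = 0, as 1 - w >= r, and then both X and X' are 0. *)
Let signed_sqrt_mul_inj X X' r w : `|X| <= r -> `|X'| <= r -> w <= 1 - r ->
  signed_sqrt X * Num.sqrt (r * (1 - w)) = signed_sqrt X' * Num.sqrt (r * (1 - w)) ->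
  X = X'.
Proof.
move=> hX hX' hw e; have r0 : 0 <= r by exact: le_trans hX.
have [rE|rn0] := eqVneq r 0.
  by move: hX hX'; rewrite rE !normr_le0 => /eqP -> /eqP ->.
have r_gt0 : 0 < r by rewrite lt_def rn0.
have n0 : Num.sqrt (r * (1 - w)) != 0.
  by rewrite lt0r_neq0 // sqrtr_gt0 mulr_gt0 //; lra.
by rewrite -(signed_sqrtK X) (mulIf n0 e) signed_sqrtK.
Qed.

(** The level l gives q. The third coordinate gives C^2, because the radicand is affine in C^2 with
    nonzero slope for distinct a and b. This fixes |X| and |Y|, and the first two coordinates fix
    the signs. *)
Lemma tet_map_inj : set_inj (@tetrahedron_surface R) tet_map.
Proof.
move=> s s' /set_mem hs /set_mem hs' e.
have [C [S [CS C2 E]]] := tet_mapP hs; have [C' [S' [CS' C2' E']]] := tet_mapP hs'.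
have el := e; rewrite E E' in el.
have /addrI/(mulfI ab0) eq := surface_point_parameter hab hb hc CS CS' el.
have [hsx _] := hs; have [hsx' _] := hs'.
have [_ hX hY] := simplex3P hsx; have [_ hX' hY'] := simplex3P hsx'.
have hq0 : 0 <= tetq s by exact: le_trans hY.
have hq1 : 0 <= 1 - tetq s by exact: le_trans hX.
rewrite -eq in hX' hY'.
have lc : 0 < c + tet_lambda (tetq s).
  rewrite /tet_lambda addrA ltr_wpDr ?mulr_ge0 ?subr_ge0 //; first exact: ltW.
  exact: addr_gt0.
have K0 (U V : R) : U ^+ 2 + V ^+ 2 = 1 -> 0 <= U ^+ 2 / (a + c) + V ^+ 2 / (b + c).
  by move=> UV; apply/ltW/sigma_plus_root_gt0.
have eC : C ^+ 2 = C' ^+ 2.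
  case: el => _ _; rewrite -eq => /(mulfI (lt0r_neq0 lc))/eqP.
  rewrite eqr_sqrt ?K0 // => /eqP; have -> : S ^+ 2 = 1 - C ^+ 2 by rewrite -CS; ring.
  have -> : S' ^+ 2 = 1 - C' ^+ 2 by rewrite -CS'; ring.
  move=> eK; apply/eqP; rewrite -subr_eq0; apply/eqP.
  have -> : C ^+ 2 - C' ^+ 2 = (a + c) * (b + c) / (b - a) *
    ((C ^+ 2 / (a + c) + (1 - C ^+ 2) / (b + c)) -
     (C' ^+ 2 / (a + c) + (1 - C' ^+ 2) / (b + c))).
    by field; rewrite -(opprB a b) oppr_eq0 ab0 !lt0r_neq0.
  by rewrite eK subrr mulr0.
rewrite C2 C2' -eq in eC.
(* Points on faces of different kinds have equal C^2 only if both are corners of the slice; the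
   bounds on |X| and |Y| force this. *)
have [eX eY] : `|tetX s| = `|tetX s'| /\ `|tetY s| = `|tetY s'|.
  case: (tetrahedron_surfaceP hs) (tetrahedron_surfaceP hs') => h [] h';
    by rewrite -eq in h'; split; lra.
have nA : (a - b) / Num.sqrt (a + c) != 0.
  by rewrite mulf_neq0 ?invr_eq0 // lt0r_neq0.
have nB : (a - b) / Num.sqrt (b + c) != 0.
  by rewrite mulf_neq0 ?invr_eq0 // lt0r_neq0.
case: e; rewrite -eq -eX -eY => /(mulfI nA) ex /(mulfI nB) ey _.
rewrite (tet_pointK hsx) (tet_pointK hsx') -eq; congr tet_point.
  by apply: signed_sqrt_mul_inj ex => //; rewrite opprB addrCA subrr addr0.
exact: signed_sqrt_mul_inj ey.
Qed.

Lemma tet_map_continuous : continuous tet_map.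
Proof.
move=> s.
have co (i : 'I_4) : {for s, continuous (fun s : 'rV[R]_4 => s 0 i)}.
  exact: coord_continuous.
have cX : {for s, continuous (@tetX R)} by exact: (cvgB (co 0) (co 1)).
have cY : {for s, continuous (@tetY R)} by exact: (cvgB (co 2) (co 3)).
have cq : {for s, continuous (@tetq R)} by exact: (cvgD (co 2) (co 3)).
have cn (f : 'rV[R]_4 -> R) :
    {for s, continuous f} -> {for s, continuous (fun x => `|f x|)}.
  by move=> cf; exact: (@continuous_comp _ _ _ f _ s cf (@norm_continuous _ _ (f s))).
have csq (f : 'rV[R]_4 -> R) :
    {for s, continuous f} -> {for s, continuous (fun x => Num.sqrt (f x))}.
  by move=> cf; exact: (@continuous_comp _ _ _ f _ s cf (@sqrt_continuous R (f s))).
have css (f : 'rV[R]_4 -> R) :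
    {for s, continuous f} -> {for s, continuous (fun x => signed_sqrt (f x))}.
  by move=> cf; exact: (@continuous_comp _ _ _ f _ s cf (@signed_sqrt_continuous R (f s))).
have cc (k : R) : {for s, continuous (fun _ : 'rV[R]_4 => k)} by exact: cst_continuous.
have cD (f g : 'rV[R]_4 -> R) : {for s, continuous f} -> {for s, continuous g} ->
    {for s, continuous (fun x => f x + g x)} by move=> cf cg; exact: (cvgD cf cg).
have cB (f g : 'rV[R]_4 -> R) : {for s, continuous f} -> {for s, continuous g} ->
    {for s, continuous (fun x => f x - g x)} by move=> cf cg; exact: (cvgB cf cg).
have cM (f g : 'rV[R]_4 -> R) : {for s, continuous f} -> {for s, continuous g} ->
    {for s, continuous (fun x => f x * g x)} by move=> cf cg; exact: (cvgM cf cg).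
have cC := cB _ _ (cD _ _ (cn _ cX) cq) (cn _ cY).
have c1 := cM _ _ (cc ((a - b) / Num.sqrt (a + c)))
  (cM _ _ (css _ cX) (csq _ (cM _ _ (cB _ _ (cc 1) cq) (cB _ _ (cc 1) (cn _ cY))))).
have c2 := cM _ _ (cc ((a - b) / Num.sqrt (b + c)))
  (cM _ _ (css _ cY) (csq _ (cM _ _ cq (cB _ _ (cc 1) (cn _ cX))))).
have c3 := cM _ _ (cD _ _ (cc c) (cD _ _ (cc b) (cM _ _ (cc (a - b)) cq)))
  (csq _ (cD _ _ (cM _ _ cC (cc (a + c)^-1)) (cM _ _ (cB _ _ (cc 1) cC) (cc (b + c)^-1)))).
exact: (cvg_pair (cvg_pair c1 c2) c3).
Qed.

Let lambda0 : tet_lambda 0 = b. Proof. by rewrite /tet_lambda mulr0 addr0. Qed.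
Let lambda1 : tet_lambda 1 = a. Proof. by rewrite /tet_lambda; ring. Qed.

Lemma T_plusE : T_plus a b c = tet_map @` @tetrahedron_surface R.
Proof.
have ab : 0 < a - b by rewrite subr_gt0.
apply/seteqP; split=> p.
  move=> [u [_ /andP[u1 u2]] <-].
  have [||s [hs _ es]] := @tet_map_onto ((u.1 - b) / (a - b)) (cos u.2) (sin u.2).
  - rewrite divr_ge0 ?subr_ge0 ?(ltW hab) //=.
    by rewrite ler_pdivrMr // mul1r lerB.
  - exact: cos2Dsin2.
  by exists s => //; rewrite es sigma_plusE /tet_lambda mulrC divfK // subrKC.
move=> [s hs <-]; have [C [S [CS _ ->]]] := tet_mapP hs.
have [t ht [<- <-]] := circle_angle CS.
have [hs' _] := hs; have [_ hX hY] := simplex3P hs'.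
have q0 : 0 <= tetq s by exact: le_trans hY.
have q1 : 0 <= 1 - tetq s by exact: le_trans hX.
exists (tet_lambda (tetq s), t) => //; split=> //=; apply/andP; split.
  by rewrite lerDl mulr_ge0 // ltW.
rewrite -lerBrDl -[leRHS]mulr1 ler_wpM2l ?(ltW ab) //.
by rewrite -subr_ge0.
Qed.

Lemma edge01E : tet_map @` tetrahedron_edge 0 1 =
  [set p | exists C S, C ^+ 2 + S ^+ 2 = 1 /\ p = surface_point a b c b C S].
Proof.
apply/seteqP; split=> p /=.
  move=> [s /tetrahedron_edge01P [hs q0] <-].
  by have [C [S [CS _ ->]]] := tet_mapP hs; exists C, S; rewrite q0 lambda0.
move=> [C [S [CS ->]]]; have [|s [hs q0 es]] := @tet_map_onto 0 C S _ CS.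
  by rewrite lexx ler01.
by rewrite lambda0 in es; exists s => //; apply/tetrahedron_edge01P.
Qed.

Lemma edge23E : tet_map @` tetrahedron_edge 2 3 =
  [set p | exists C S, C ^+ 2 + S ^+ 2 = 1 /\ p = surface_point a b c a C S].
Proof.
apply/seteqP; split=> p /=.
  move=> [s /tetrahedron_edge23P [hs q1] <-].
  by have [C [S [CS _ ->]]] := tet_mapP hs; exists C, S; rewrite q1 lambda1.
move=> [C [S [CS ->]]]; have [|s [hs q1 es]] := @tet_map_onto 1 C S _ CS.
  by rewrite lexx ler01.
by rewrite lambda1 in es; exists s => //; apply/tetrahedron_edge23P.
Qed.

Lemma mixed_edgeP (i j : 'I_4) s : (i < 2 <= j)%N -> tetrahedron_edge i j s -> exists C S,
  [/\ C ^+ 2 + S ^+ 2 = 1, S ^+ 2 = tetq s &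
      tet_map s = surface_point a b c (b + (a - b) * S ^+ 2) C S].
Proof.
move=> ij hs; have hsurf := tetrahedron_edge_surface hs.
have [eX eY] : `|tetX s| = 1 - tetq s /\ `|tetY s| = tetq s.
  by apply/(tetrahedron_edge_mixed hsurf); exists i, j.
have [C [S [CS C2 ->]]] := tet_mapP hsurf; exists C, S.
have S2 : S ^+ 2 = tetq s by rewrite eX eY in C2; lra.
by split=> //; rewrite S2.
Qed.

Lemma mixed_edgesE :
  [set p | exists i j : 'I_4, (i < 2 <= j)%N /\ (tet_map @` tetrahedron_edge i j) p] =
  [set p | exists C S, C ^+ 2 + S ^+ 2 = 1 /\
                       p = surface_point a b c (b + (a - b) * S ^+ 2) C S].
Proof.
apply/seteqP; split=> p /=.
  move=> [i [j [ij [s hs <-]]]].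
  by have [C [S [CS _ ->]]] := mixed_edgeP ij hs; exists C, S.
move=> [C [S [CS ->]]].
have C2 : 1 - S ^+ 2 = C ^+ 2 by rewrite -CS; ring.
have nsq (v : R) : `|v * `|v| | = v ^+ 2.
  by rewrite normrM normr_id -expr2 real_normK ?num_real.
(* On the mixed edges the diamond touches the rectangle, so neither coordinate is moved. *)
pose s := tet_point (C * `|C|) (- S * `|- S|) (S ^+ 2).
have hs : tetrahedron_surface s.
  by apply: tet_point_surface; rewrite ?nsq ?sqrrN ?C2 //; left.
have [i [j [ij hij]]] : exists i j : 'I_4, (i < 2 <= j)%N /\ tetrahedron_edge i j s.
  by apply/(tetrahedron_edge_mixed hs); rewrite tetX_point tetY_point tetq_point !nsq sqrrN.
exists i, j; split=> //; exists s => //.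
have sqrtrr (v : R) : Num.sqrt (v ^+ 2 * v ^+ 2) = v ^+ 2.
  by rewrite -expr2 sqrtr_sqr ger0_norm // sqr_ge0.
have := @tet_map_surface_point s C S CS.
rewrite tetX_point tetY_point tetq_point !nsq sqrrN C2; apply.
- by rewrite addrK.
- by rewrite signed_sqr_sqrt sqrtrr mulrC.
have -> : 1 - C ^+ 2 = S ^+ 2 by rewrite -C2; ring.
by rewrite signed_sqr_sqrt sqrtrr; ring.
Qed.

Lemma tet_map_vertex i : tet_map (delta_mx 0 i) = vertex a b c i.
Proof.
rewrite vertexE // /surface_point /tet_map /tetX /tetY /tetq /tet_lambda !mxE.
have ss0 : signed_sqrt (0 : R) = 0 by rewrite signed_sqrt_ge0 ?sqrtr0.
have ss1 : signed_sqrt (1 : R) = 1 by rewrite signed_sqrt_ge0 ?sqrtr1.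
case: (ord4P i) => -> /=; rewrite !(add0r, addr0, subr0, sub0r, subrr, normr0, normrN,
  normr1, signed_sqrtN, ss0, ss1, sqrtr1, mulr1, mul1r, mul0r, mulr0, sqrrN, expr1n, expr0n) /=
  ?(mul0r, addr0, add0r); congr (_, _, _); rewrite ?subrKC //; ring.
Qed.

End TetrahedronMap.

(** * The proposition *)

Lemma circle_abscissa (R : realType) (x r : R) : 0 < r -> `|x| <= r <->
  exists C S, C ^+ 2 + S ^+ 2 = 1 /\ x = r * C.
Proof.
move=> r0; split=> [hx|[C [S [CS ->]]]].
  have x2 : (x / r) ^+ 2 <= 1.
    have x1 : `|x / r| <= 1.
      by rewrite normrM normfV (gtr0_norm r0) ler_pdivrMr // mul1r.
    by rewrite -real_normK ?num_real // exprn_ile1.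
  exists (x / r), (Num.sqrt (1 - (x / r) ^+ 2)); split.
    by rewrite sqr_sqrtr ?subr_ge0 // addrC subrK.
  by rewrite mulrC divfK // lt0r_neq0.
rewrite normrM (gtr0_norm r0) ger_pMr // -(expr_le1 (n := 2)) // real_normK ?num_real //.
by rewrite -CS lerDl sqr_ge0.
Qed.

Lemma circle_axis (R : realType) (C S : R) :
  C ^+ 2 + S ^+ 2 = 1 -> S = 0 -> C = 1 \/ C = -1.
Proof.
move=> + S0; rewrite S0 expr0n addr0 => /eqP; rewrite sqrf_eq1.
by case/orP => /eqP; [left|right].
Qed.

Lemma circle_pole (R : realType) (C S : R) :
  C ^+ 2 + S ^+ 2 = 1 -> C = 1 \/ C = -1 -> S = 0.
Proof.
move=> CS hC; have C1 : C ^+ 2 = 1 by case: hC => ->; rewrite ?sqrrN expr1n.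
by apply/eqP; rewrite -sqrf_eq0 -(addKr (C ^+ 2) (S ^+ 2)) CS C1 addNr.
Qed.

Lemma tetrahedron_edgeC (R : realType) i j (s : 'rV[R]_4) :
  tetrahedron_edge i j s -> tetrahedron_edge j i s.
Proof. by move=> [hs h]; split=> // k ki kj; exact: h. Qed.

Section MainParts.
Variables (R : realType) (a b c : R).
Hypotheses (hab : b < a) (hb : 0 < b) (hc : 0 < c).

Let F := sigma_plus a b c.
Let V := vertex a b c.
Let E i j := tet_map a b c @` @tetrahedron_edge R i j.

Let ac0 : 0 < a + c. Proof. by rewrite addr_gt0 // (lt_trans hb). Qed.
Let bc0 : 0 < b + c. Proof. by rewrite addr_gt0. Qed.
Let A0 : 0 < Num.sqrt (a + c). Proof. by rewrite sqrtr_gt0. Qed.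
Let B0 : 0 < Num.sqrt (b + c). Proof. by rewrite sqrtr_gt0. Qed.
Let ab_gt0 : 0 < a - b. Proof. by rewrite subr_gt0. Qed.
Let ab0 : a - b != 0. Proof. exact: lt0r_neq0. Qed.
Let nab : a != b. Proof. by rewrite gt_eqF. Qed.
Let nba : b != a. Proof. by rewrite eq_sym. Qed.

Let V0 : V 0 = surface_point a b c b 1 0. Proof. by rewrite /V vertexE. Qed.
Let V1 : V 1 = surface_point a b c b (- 1) 0. Proof. by rewrite /V vertexE. Qed.
Let V2 : V 2 = surface_point a b c a 0 (- 1). Proof. by rewrite /V vertexE. Qed.
Let V3 : V 3 = surface_point a b c a 0 1. Proof. by rewrite /V vertexE. Qed.

Let CSt (t : R) : cos t ^+ 2 + sin t ^+ 2 = 1. Proof. exact: cos2Dsin2. Qed.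
Let C10 : 1 ^+ 2 + 0 ^+ 2 = 1 :> R. Proof. by rewrite expr1n expr0n addr0. Qed.
Let CN10 : (- 1) ^+ 2 + 0 ^+ 2 = 1 :> R. Proof. by rewrite sqrrN. Qed.
Let C01 : 0 ^+ 2 + 1 ^+ 2 = 1 :> R. Proof. by rewrite addrC. Qed.
Let C0N1 : 0 ^+ 2 + (- 1) ^+ 2 = 1 :> R. Proof. by rewrite sqrrN. Qed.

Let spE l C S l' C' S' := @surface_point_parameter R a b c hab hb hc l C S l' C' S'.

Let spC C S C' S' :
  surface_point a b c b C S = surface_point a b c b C' S' -> C = C'.
Proof. exact: surface_point_cos. Qed.

Let spS C S C' S' :
  surface_point a b c a C S = surface_point a b c a C' S' -> S = S'.
Proof. exact: surface_point_sin. Qed.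

Lemma edge01_shorter_arc : is_shorter_arc (conic_xz a b c) (V 0) (V 1) (E 0 1).
Proof.
pose u0 := (a - b) / Num.sqrt (a + c).
have u0_gt0 : 0 < u0 by rewrite divr_gt0.
have cb : 0 < c + b by rewrite addrC.
(* The quantity is z^2 at V_1, whose abscissa is [u0]. *)
have PQ : 0 < c + b + - (c + b) / (a - b) * u0 ^+ 2.
  have -> : c + b + - (c + b) / (a - b) * u0 ^+ 2 = (b + c) ^+ 2 / (a + c).
    rewrite exprMn exprVn sqr_sqrtr ?(ltW ac0) //.
    by field; rewrite ab0 lt0r_neq0.
  by rewrite divr_gt0 // exprn_gt0.
have := conic_graph_shorter_arc false u0_gt0 cb PQ.
rewrite conic_xzE // V0 V1 !surface_point_xz // mulr1 mulrN1 /E edge01E //.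
congr (is_shorter_arc _ _ _ _); apply/seteqP; split=> p /=.
  move=> [x /(circle_abscissa _ u0_gt0) [C [S [CS ->]]] <-].
  by exists C, S; rewrite surface_point_xz.
move=> [C [S [CS ->]]]; rewrite surface_point_xz //; exists (u0 * C) => //.
by apply/(circle_abscissa _ u0_gt0); exists C, S.
Qed.

Lemma edge23_shorter_arc : is_shorter_arc (conic_yz a b c) (V 2) (V 3) (E 2 3).
Proof.
pose u0 := (a - b) / Num.sqrt (b + c).
have u0_gt0 : 0 < u0 by rewrite divr_gt0.
have ca : 0 < c + a by rewrite addrC.
have PQ : 0 < c + a + (c + a) / (a - b) * u0 ^+ 2.
  by rewrite addr_gt0 // mulr_gt0 ?divr_gt0 ?exprn_gt0.
have := conic_graph_shorter_arc true u0_gt0 ca PQ.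
rewrite conic_yzE // V2 V3 !surface_point_yz // opprK mulr1 mulrN1 /E edge23E //.
congr (is_shorter_arc _ _ _ _); apply/seteqP; split=> p /=.
  move=> [x /(circle_abscissa _ u0_gt0) [C [S [CS ->]]] <-].
  by exists S, (- C); rewrite sqrrN addrC surface_point_yz ?opprK // sqrrN addrC.
move=> [C [S [CS ->]]]; rewrite surface_point_yz //; exists (u0 * - S) => //.
by apply/(circle_abscissa _ u0_gt0); exists (- S), C; rewrite sqrrN addrC.
Qed.

(** At l = b the points with S and - S coincide, at l = a those with C and - C. The fixed points of
    these foldings, S = 0 and C = 0, have one preimage only and are the vertices; hence the set
    differences. *)
Lemma sigma_plus_self_intersection : self_intersection F (@param_domain R) =
  (E 0 1 `\` [set V 0; V 1]) `|` (E 2 3 `\` [set V 2; V 3]).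
Proof.
rewrite /E edge01E // edge23E //; apply/seteqP; split=> p /=.
  move=> [u [v [/= hu hv uv eu ev]]].
  rewrite /F !sigma_plusE in eu ev.
  have euv := etrans eu (esym ev).
  have el := spE (CSt u.2) (CSt v.2) euv.
  rewrite -el in euv ev.
  have cos_sin : cos u.2 = cos v.2 -> sin u.2 = sin v.2 -> False.
    move=> ec es; apply: uv; rewrite [u]surjective_pairing [v]surjective_pairing el.
    by rewrite (circle_angle_inj hu hv ec es).
  have [ub|ub] := eqVneq u.1 b.
    left; rewrite ub in eu euv.
    have ec : cos u.2 = cos v.2 by exact: surface_point_cos euv.
    split; first by exists (cos u.2), (sin u.2).
    rewrite V0 V1 -eu => ep.
    have cu : cos u.2 = 1 \/ cos u.2 = -1.
      by case: ep => /spC; [left|right].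
    apply: cos_sin => //.
    by rewrite (circle_pole (CSt u.2) cu) (circle_pole (CSt v.2)) // -ec.
  have [ua|ua] := eqVneq u.1 a; last first.
    exfalso; apply: cos_sin; [exact: surface_point_cos euv|exact: surface_point_sin euv].
  right; rewrite ua in eu euv.
  have es : sin u.2 = sin v.2 by exact: surface_point_sin euv.
  split; first by exists (cos u.2), (sin u.2).
  rewrite V2 V3 -eu => ep.
  have su : sin u.2 = 1 \/ sin u.2 = -1.
    by case: ep => /spS; [right|left].
  apply: cos_sin => //.
  rewrite (@circle_pole _ (sin u.2) (cos u.2)) ?[_ + cos _ ^+ 2]addrC //.
  by rewrite (@circle_pole _ (sin v.2) (cos v.2)) ?[_ + cos _ ^+ 2]addrC // -es.
have pair l C S C' S' : C ^+ 2 + S ^+ 2 = 1 -> C' ^+ 2 + S' ^+ 2 = 1 ->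
    surface_point a b c l C S = surface_point a b c l C' S' ->
    C <> C' \/ S <> S' ->
    self_intersection F (@param_domain R) (surface_point a b c l C S).
  move=> CS CS' e ne; have [t ht [ct st]] := circle_angle CS.
  have [t' ht' [ct' st']] := circle_angle CS'.
  exists (l, t), (l, t'); split=> //; rewrite /F ?sigma_plusE /= ?ct ?st ?ct' ?st' //.
  by move=> [tt]; case: ne; apply; [rewrite -ct tt|rewrite -st tt].
move=> [[[C [S [CS ->]]] nV]|[[C [S [CS ->]]] nV]].
  apply: (pair _ _ _ C (- S)) => //; first by rewrite sqrrN.
    by rewrite /surface_point subrr !mul0r sqrrN.
  right=> SN; apply: nV; have S0 : S = 0 by lra.
  by rewrite V0 V1; case: (circle_axis CS S0) => ->; rewrite S0; [left|right].
apply: (pair _ _ _ (- C) S) => //; first by rewrite sqrrN.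
  by rewrite /surface_point subrr !mul0r sqrrN.
left=> CN; apply: nV; have C0 : C = 0 by lra.
rewrite addrC in CS.
by rewrite V2 V3; case: (circle_axis CS C0) => ->; rewrite C0; [right|left].
Qed.

(** The relation amounts to l = b + (a - b) sin^2 t, which already places l in [b, a]. *)
Lemma mixed_edges_relation :
  [set p | exists i j : 'I_4, (i < 2 <= j)%N /\ E i j p] =
  F @` [set u | param_domain u /\
                - a - b + 2 * u.1 + (a - b) * cos (2 * u.2) = 0].
Proof.
have relE (u : plane R) : - a - b + 2 * u.1 + (a - b) * cos (2 * u.2) =
    2 * (u.1 - (b + (a - b) * sin u.2 ^+ 2)) by rewrite cos_double; ring.
rewrite /E mixed_edgesE //; apply/seteqP; split=> p /=.
  move=> [C [S [CS ->]]]; have [t ht [ct st]] := circle_angle CS.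
  exists (b + (a - b) * S ^+ 2, t); last by rewrite /F sigma_plusE /= ct st.
  by split=> //; rewrite relE /= st subrr mulr0.
move=> [u [hu]]; rewrite relE => /eqP; rewrite mulf_eq0 pnatr_eq0 /= subr_eq0 => /eqP ul <-.
by exists (cos u.2), (sin u.2); rewrite /F sigma_plusE ul.
Qed.

(** Inside a mixed edge both barycentric coordinates are nonzero, so q and 1 - q are, and with them
    S and C. Then l is neither a nor b, so any parameter [u] of the point has this cosine and sine,
    and [sin (2 * u.2)] is nonzero. *)
Lemma mixed_edge_cuspidal (i j : 'I_4) (u : plane R) : (i < 2 <= j)%N ->
  (E i j `\` [set V i; V j]) (F u) -> cuspidal_edge_at F u.
Proof.
move=> ij [[s hs es] nV]; have [C [S [CS S2 esp]]] := mixed_edgeP hab hb hc ij hs.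
have ij' : i != j by case/andP: ij => i2 j2; apply/eqP => e; rewrite e ltnNge j2 in i2.
have si0 : s 0 i != 0.
  apply/eqP => si; apply: nV; right.
  by rewrite /V -tet_map_vertex // -(tetrahedron_edge_vertex ij' hs si) -es.
have sj0 : s 0 j != 0.
  apply/eqP => sj; apply: nV; left; rewrite /V -tet_map_vertex //.
  by rewrite -(tetrahedron_edge_vertex _ (tetrahedron_edgeC hs) sj) 1?eq_sym.
have [hsimplex _] := hs; have [s_ge0 _] := hsimplex.
have s_sum (k l : 'I_4) : s 0 k != 0 \/ s 0 l != 0 -> s 0 k + s 0 l != 0.
  by rewrite paddr_eq0 // negb_and => -[] ->; rewrite ?orbT.
have q0 : tetq s != 0.
  apply: s_sum; case/andP: ij => _; move: sj0.
  by case: (ord4P j) => -> // sj _; [left|right].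
have C2E : C ^+ 2 = 1 - S ^+ 2 by rewrite -CS; ring.
have C2 : C ^+ 2 != 0.
  have [e _ _] := simplex3P hsimplex; rewrite C2E S2 -e; apply: s_sum.
  case/andP: ij => + _; move: si0.
  by case: (ord4P i) => -> // si _; [left|right].
have S0 : S != 0 by rewrite -sqrf_eq0 S2.
have C0 : C != 0 by rewrite -sqrf_eq0.
rewrite esp /F sigma_plusE in es.
have ul := spE CS (CSt u.2) es; rewrite -ul in es.
have cu : C = cos u.2.
  apply: surface_point_cos es => //.
  have lE : b + (a - b) * S ^+ 2 - a = - ((a - b) * C ^+ 2) by rewrite C2E; ring.
  by rewrite -subr_eq0 lE oppr_eq0 mulf_neq0.
have su : S = sin u.2.
  apply: surface_point_sin es => //.
  by rewrite -subr_eq0 addrAC subrr add0r mulf_neq0 // expf_neq0.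
rewrite [u]surjective_pairing; apply: cuspidal_edge_normal_form => //.
  by rewrite sin_double !mulf_neq0 ?pnatr_eq0 // -?cu -?su.
by rewrite -su ul.
Qed.

(** The point determines l, which is a or b, and then the one of sine and cosine that is 1 or - 1;
    the other one vanishes. *)
Lemma vertex_swallowtail (i : 'I_4) (u : plane R) :
  F u = V i -> swallowtail_at F u.
Proof.
rewrite [u]surjective_pairing /F sigma_plusE; set l := u.1; set t := u.2 => /=.
have cos0 : sin t = 1 \/ sin t = -1 -> cos t = 0.
  by apply: circle_pole; rewrite addrC.
case: (ord4P i) => ->; rewrite ?V0 ?V1 ?V2 ?V3 => e;
  have le := spE (CSt t) _ e; rewrite le // in e *.
- by apply: swallowtail_sin0 => //; apply: circle_pole (CSt t) _; left; exact: spC e.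
- by apply: swallowtail_sin0 => //; apply: circle_pole (CSt t) _; right; exact: spC e.
- by apply: swallowtail_cos0 => //; apply: cos0; right; exact: spS e.
- by apply: swallowtail_cos0 => //; apply: cos0; left; exact: spS e.
Qed.

End MainParts.
Theorem proposition4p5 (R : realType) (a b c : R)
    (hab : b < a) (hb : 0 < b) (hc : 0 < c) :
  let F := sigma_plus a b c in
  let V := vertex a b c in
  exists E : 'I_4 -> 'I_4 -> set (space3 R),
    [/\ curved_tetrahedron (T_plus a b c) V E,
        is_shorter_arc (conic_xz a b c) (V 0) (V 1) (E 0 1) /\
        is_shorter_arc (conic_yz a b c) (V 2) (V 3) (E 2 3),
        self_intersection F (@param_domain R) =
          (E 0 1 `\` [set V 0; V 1]) `|` (E 2 3 `\` [set V 2; V 3]),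
        [set p | exists i j : 'I_4, (i < 2 <= j)%N /\ E i j p] =
          F @` [set u | param_domain u /\
                        - a - b + 2 * u.1 + (a - b) * cos (2 * u.2) = 0] &
        (forall (i j : 'I_4) (u : plane R), (i < 2 <= j)%N ->
           param_domain u -> (E i j `\` [set V i; V j]) (F u) ->
           cuspidal_edge_at F u) /\
        (forall (i : 'I_4) (u : plane R),
           param_domain u -> F u = V i -> swallowtail_at F u)].
Proof.
move=> F V; exists (fun i j => tet_map a b c @` @tetrahedron_edge R i j); split.
- exists (tet_map a b c); split=> //.
  + exact/continuous_subspaceT/tet_map_continuous.
  + exact: tet_map_inj.
  + by rewrite T_plusE.
  + by move=> i; exact: tet_map_vertex.
- by split; [exact: edge01_shorter_arc|exact: edge23_shorter_arc].
- exact: sigma_plus_self_intersection.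
- exact: mixed_edges_relation.
split.
- by move=> i j u ij _; exact: mixed_edge_cuspidal.
- by move=> i u _; exact: vertex_swallowtail.
Qed.
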